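(* Let $(\pi_\epsilon)_{\epsilon>0}$ be a family of discrete probability distributions on $\mathbb{R}$, each with zero mean, unit variance and finite entropy $H_\epsilon := H(\pi_\epsilon)$, whose single-letter MMSE functions $M_\epsilon$ satisfy $$\lim_{\epsilon\to 0} M_\epsilon(2H_\epsilon t) = \begin{cases} 1, & t\in[0,1)\\ 0, & t\in(1,\infty).\end{cases}$$ Let $r\in(0,1)\cup(1,\infty)$ and let $(\delta_\epsilon,\mathsf{snr}_\epsilon,\pi_\epsilon)_{\epsilon>0}$ be a family of triplets with $\delta_\epsilon,\mathsf{snr}_\epsilon\in(0,\infty)$ such that $$\lim_{\epsilon\to 0}\frac{\delta_\epsilon}{\delta_{\epsilon,\mathrm{AMP}}} = r,\qquad \text{where } \delta_{\epsilon,\mathrm{AMP}} := \frac{2H_\epsilon(1+\mathsf{snr}_\epsilon)}{\mathsf{snr}_\epsilon}.$$ Let $s^{\mathrm{AMP}}_\epsilon$ be the smallest stationary point of the potential function $\mathcal{F}_\epsilon$ associated with $(\delta_\epsilon,\mathsf{snr}_\epsilon,\pi_\epsilon)$. Then: $$r\in(0,1)\ \Longrightarrow\ \lim_{\epsilon\to0} M_\epsilon(s^{\mathrm{AMP}}_\epsilon) = 1,\qquad\qquad r\in(1,\infty)\ \Longrightarrow\ \lim_{\epsilon\to0} M_\epsilon(s^{\mathrm{AMP}}_\epsilon)=0.$$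
   Context: Logarithms are natural and entropies and mutual informations are in nats. For a distribution $\pi_\epsilon$, let $\beta_0\sim\pi_\epsilon$ and $N\sim\mathcal{N}(0,1)$ be independent. For $s\ge 0$ define the single-letter mutual information and MMSE functions $$I_\epsilon(s) := I(\beta_0;\sqrt{s}\,\beta_0+N),\qquad M_\epsilon(s) := \mathbb{E}\big[(\beta_0-\mathbb{E}[\beta_0\mid \sqrt{s}\,\beta_0+N])^2\big].$$ The potential function associated with $(\delta_\epsilon,\mathsf{snr}_\epsilon,\pi_\epsilon)$ is $$\mathcal{F}_\epsilon(s) := I_\epsilon(s)+\frac{\delta_\epsilon}{2}\,\phi\!\left(\frac{s}{\delta_\epsilon\,\mathsf{snr}_\epsilon}\right),\quad s>0,\qquad \phi(x) := x-\log x-1,$$ and its smallest stationary point is $s^{\mathrm{AMP}}_\epsilon := \inf\{s>0:\mathcal{F}_\epsilon'(s)=0\}$. *)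

(* Defs.v *)
From HB Require Import structures.
From mathcomp Require Import all_boot all_order all_algebra.
From mathcomp Require Import all_classical all_reals all_analysis.
From mathcomp Require Import measurable_realfun.

Set Implicit Arguments.
Unset Strict Implicit.
Unset Printing Implicit Defensive.

Import Order.TTheory GRing.Theory Num.Theory.
Import numFieldNormedType.Exports.

Local Open Scope classical_set_scope.
Local Open Scope ring_scope.

Section discrete_distributions.
Context {R : realType}.
Implicit Type P : probability (measurableTypeR R) R.

Definition discrete_distribution P : Prop :=
  exists A : set R, countable A /\ P A = 1%E.

(* Since ln 0 = 0 in the library, points of mass zero contribute nothing. *)
Definition entropy P : \bar R :=
  \esum_(x in [set: R]) (- (fine (P [set x]) * ln (fine (P [set x]))))%:E.

End discrete_distributions.

Section mutual_information.
Context {R : realType}.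

Definition kl_divergence d (T : measurableType d) (P Q : probability T R) :
    \bar R :=
  if `[< P `<< Q >] then
    (\int[P]_x lne (Radon_Nikodym (charge_of_finite_measure P) Q x))%E
  else +oo%E.

Context d d1 d2 (T : measurableType d) (T1 : measurableType d1)
  (T2 : measurableType d2) (P : probability T R).

Definition pair_rv (X : {mfun T >-> T1}) (Y : {mfun T >-> T2}) (w : T) :
    T1 * T2 := (X w, Y w).

Section pair_rv_measurable.
Variables (X : {mfun T >-> T1}) (Y : {mfun T >-> T2}).

Let measurable_pair_rv : measurable_fun [set: T] (pair_rv X Y).
Proof. exact: measurable_fun_pair. Qed.

HB.instance Definition _ := isMeasurableFun.Build _ _ _ _ (pair_rv X Y)
  measurable_pair_rv.
End pair_rv_measurable.

Definition mutual_information (X : {mfun T >-> T1}) (Y : {mfun T >-> T2}) :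
    \bar R :=
  kl_divergence (distribution P (pair_rv X Y))
    (distribution P X \x distribution P Y)%E.

End mutual_information.

Section mmse.
Context {R : realType} d d' (T : measurableType d) (T' : measurableType d')
  (P : probability T R).

(* Z is a version of E[X | Y]: measurable for the sigma-algebra generated by Y,
   whose members are the preimages of measurable sets under Y. *)
Definition is_cond_expectation (X : T -> R) (Y : T -> T') (Z : T -> R) : Prop :=
  [/\ measurable_fun [set: g_sigma_algebra_preimageType Y] Z,
      P.-integrable [set: T] (EFin \o Z) &
      forall B : set T', measurable B ->
        (\int[P]_(w in Y @^-1` B) (Z w)%:E =
         \int[P]_(w in Y @^-1` B) (X w)%:E)%E].

(* A chosen version; for integrable X and measurable Y one exists and any two
   agree P-almost surely, so expectations do not depend on the choice. *)
Definition cond_expectation (X : T -> R) (Y : T -> T') : T -> R :=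
  xget (cst 0) [set Z | is_cond_expectation X Y Z].

Definition mmse (X : T -> R) (Y : T -> T') : \bar R :=
  ('E_P[(fun w => (X w - cond_expectation X Y w) ^+ 2)%R])%E.

End mmse.

Section scalar_gaussian_channel.
Context {R : realType}.

(* The pair (beta_0, N) is realised as the two coordinates on the product of
   pi and N(0, 1); the second parameter of normal_prob is the standard
   deviation. *)
Definition channel_prob (pi : probability (measurableTypeR R) R) :
    probability (measurableTypeR R * measurableTypeR R)%type R :=
  (pi \x (normal_prob 0 1 : probability (measurableTypeR R) R))%E.

Definition channel_input (w : measurableTypeR R * measurableTypeR R) :
    measurableTypeR R := w.1.

Definition channel_output (s : R) (w : measurableTypeR R * measurableTypeR R) :
    measurableTypeR R := Num.sqrt s * w.1 + w.2.

Let measurable_channel_input :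
  measurable_fun [set: measurableTypeR R * measurableTypeR R] channel_input.
Proof. exact: measurable_fst. Qed.

HB.instance Definition _ := isMeasurableFun.Build _ _ _ _ channel_input
  measurable_channel_input.

Let measurable_channel_output (s : R) :
  measurable_fun [set: measurableTypeR R * measurableTypeR R]
    (channel_output s).
Proof.
apply: measurable_funD; last exact: measurable_snd.
by apply: measurable_funM => //; exact: measurable_fst.
Qed.

HB.instance Definition _ (s : R) := isMeasurableFun.Build _ _ _ _
  (channel_output s) (measurable_channel_output s).

Implicit Type pi : probability (measurableTypeR R) R.

(* Real-valued: the mutual information is at most the entropy of pi, and the
   MMSE at most its variance. *)
Definition I_fun pi (s : R) : R :=
  fine (mutual_information (channel_prob pi) channel_input (channel_output s)).

Definition M_fun pi (s : R) : R :=
  fine (mmse (channel_prob pi) channel_input (channel_output s)).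

Definition phi (x : R) : R := x - ln x - 1.

Definition potential (delta snr : R) pi (s : R) : R :=
  I_fun pi s + delta / 2 * phi (s / (delta * snr)).

(* Differentiability is stated separately because derive1 is total. *)
Definition stationary_points (F : R -> R) : set R :=
  [set s : R | [/\ 0 < s, derivable F s 1 & derive1 F s = 0]].

Definition s_AMP (delta snr : R) pi : R :=
  inf (stationary_points (potential delta snr pi)).

Definition delta_AMP (snr : R) pi : R :=
  2 * fine (entropy pi) * (1 + snr) / snr.

End scalar_gaussian_channel.

(* Main.v *)
Require Import Defs.
From HB Require Import structures.
From mathcomp Require Import all_boot all_order all_algebra.
From mathcomp Require Import all_classical all_reals all_analysis.
From mathcomp Require Import measurable_realfun ring lra.

Set Implicit Arguments.
Unset Strict Implicit.
Unset Printing Implicit Defensive.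

Import Order.TTheory GRing.Theory Num.Theory.
Import numFieldNormedType.Exports.
Local Open Scope classical_set_scope.
Local Open Scope ring_scope.

(** Put [t = Num.sqrt s], so that the channel output is [t * beta + n]; let [m_t]
    be the posterior mean of the input given the output and [e t] the second
    moment of [m_t] at the output. For a standardized input, [M s = 1 - e t].

    The theorem rests on four properties of the scalar channel: [M] takes its
    values in [0, 1], is nonincreasing, is continuous, and is twice the
    derivative of the mutual information [I] ([is_derive_I_fun]). By the last
    one, a point [s > 0] is stationary for the potential exactly when
    [s * (M s * snr + 1) = delta * snr] ([stationaryP]). With
    [rho = delta / delta_AMP], the right-hand side is [2 * H * rho * (snr + 1)].
    - As [M s <= 1], every stationary point is at least [2 * H * rho]. If
      [rho] tends to [r > 1], the smallest one eventually lies beyond [2 * H * t]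
      for a fixed [t] in ]1, r[, where [M] tends to 0; monotonicity concludes.
    - At [s = 2 * H * t] with [r < t < 1], [M s] tends to 1, so the left-hand
      side, at least [2 * H * t * M s * (snr + 1)], eventually exceeds the
      right-hand side. By the intermediate value theorem a stationary point lies
      below [2 * H * t], where [M] is at least [M (2 * H * t)], which tends to 1.

    The derivative of [I] comes from a single inequality valid for all amplitudes
    ([info_tangent], [I_fun_increment]):
      [I s' - I s <= (s' - s) / 2 * M s + (Num.sqrt s' - Num.sqrt s) ^+ 2 / 2].
    Up to a constant [I s'] is minus the mean of the log output density at its
    own output. By the Gibbs inequality that mean does not increase when the
    density is replaced by the one of parameter [s]; and a Gaussian mixture has a
    log density which is convex up to a quadratic term, so it is bounded below by
    its tangent at the output of parameter [s], taken with the same noise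
    ([outpdf_tangent]). The slope of the convex part is a multiple of the
    posterior mean, which makes [M s] appear. Exchanging [s] and [s'] gives the
    opposite inequality with [M s'], and continuity of [M] closes the gap
    ([is_derive_supergradient]).

    Monotonicity of [M] holds because the output of a worse channel is obtained
    from that of a better one by scaling and adding independent noise, by the
    rotation invariance of the Gaussian ([gauss_stable], [explained_lt]).
    Continuity follows from two applications of Fatou's lemma: [e t] and
    [1 - e t] are both integrals over the output of nonnegative functions which
    are continuous in [t], so both are lower semicontinuous
    ([continuous_explained]).

    Everything else identifies the abstract quantities with explicit integrals:
    the joint law has density [lik t x y], the likelihood ratio is the
    Radon-Nikodym derivative that defines the mutual information
    ([kl_divergence_density], [I_funE]), and the posterior mean is a version of
    the conditional expectation ([postmean_is_cond_expectation], [M_funE]). *)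

(** * Affine changes of variable for the Lebesgue integral *)

Section lebesgue_affine.
Context {R : realType}.
Local Notation mu := (@lebesgue_measure R).

Lemma measurable_affine (c d : R) :
  measurable_fun [set: measurableTypeR R]
    (fun x : measurableTypeR R => c * x + d : measurableTypeR R).
Proof. by apply: measurable_funD => //; exact: measurable_funM. Qed.

Lemma lebesgue_measure_affine (c d : R) : 0 < c ->
  forall A, measurable A ->
  mu A = (c%:E * mu ((fun x : R => (c * x + d)%R) @^-1` A))%E.
Proof.
move=> c0.
pose phi : measurableTypeR R -> measurableTypeR R := fun x => c * x + d.
have mphi : measurable_fun setT phi by exact: measurable_affine.
have c0' : 0 <= c by exact: ltW.
pose phi' : {mfun measurableTypeR R >-> measurableTypeR R} :=
  HB.pack phi (isMeasurableFun.Build _ _ _ _ phi mphi).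
apply: (@lebesgue_measure_unique _ (mscale (NngNum c0') (pushforward mu phi'))).
move=> _ [[a b]] _ <-.
transitivity (c%:E * mu (phi @^-1` `]a, b]))%E; last by [].
rewrite (_ : phi @^-1` `]a, b] = `](a - d) / c, (b - d) / c]%classic); last first.
  apply/seteqP; split => x /=; rewrite !in_itv/= /phi ltr_pdivrMr// ler_pdivlMr//;
    rewrite ltrBlDr lerBrDr [x * c]mulrC//.
rewrite !lebesgue_measure_itv/= !lte_fin ltr_pM2r ?invr_gt0// ltrD2r.
case: ifPn => _; last by rewrite mule0.
by rewrite -!EFinB -EFinM; congr EFin; field; rewrite gt_eqF.
Qed.

(** A measurable integrand is enough, because the change of variable takes
    place at the level of measures: a multiple of the pushforward of Lebesgue
    measure is Lebesgue measure, as half-open intervals show. *)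
Lemma ge0_integral_affine (c d : R) (h : R -> \bar R) : 0 < c ->
  measurable_fun [set: R] h -> (forall x, 0 <= h x)%E ->
  (\int[mu]_x h x = c%:E * \int[mu]_x h (c * x + d)%R)%E.
Proof.
move=> c0 mh h0.
pose phi : measurableTypeR R -> measurableTypeR R := fun x => c * x + d.
have mphi : measurable_fun setT phi by exact: measurable_affine.
have c0' : 0 <= c by exact: ltW.
transitivity (c%:E * \int[mu]_(x in phi @^-1` setT) (h \o phi) x)%E; last by [].
rewrite -(ge0_integral_pushforward mphi)//.
rewrite -(@ge0_integral_mscale _ _ _ _ _ _ (NngNum c0'))//.
by apply: eq_measure_integral => A mA _; exact: lebesgue_measure_affine.
Qed.
End lebesgue_affine.

(** * The standard Gaussian density *)

Section standard_gaussian.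
Context {R : realType}.
Local Notation mu := (@lebesgue_measure R).
Local Notation gauss := (normal_prob (0:R) 1 : probability (measurableTypeR R) R).

Definition gpdf (x : R) : R := normal_pdf 0 1 x.

Lemma gpdfE x : gpdf x = normal_peak 1 * expR (- (x ^+ 2 / 2)).
Proof.
by rewrite /gpdf normal_pdfE ?oner_eq0// /normal_fun subr0 expr1n mulNr.
Qed.

Lemma gpdf_gt0 x : 0 < gpdf x.
Proof. by rewrite gpdfE mulr_gt0 ?expR_gt0// normal_peak_gt0 ?oner_eq0. Qed.

Lemma gpdf_ge0 x : 0 <= gpdf x. Proof. exact/ltW/gpdf_gt0. Qed.

Lemma gpdf_le x : gpdf x <= normal_peak 1.
Proof. by apply: normal_pdf_ub; rewrite oner_eq0. Qed.

Lemma measurable_gpdf_comp d (T : measurableType d) (phi : T -> R) :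
  measurable_fun setT phi -> measurable_fun setT (fun x => (gpdf (phi x))%:E).
Proof.
move=> mphi; apply/measurable_EFinP.
by apply: (measurableT_comp (measurable_normal_pdf 0 1)).
Qed.

Lemma continuous_gpdf : continuous gpdf.
Proof. by apply: continuous_normal_pdf; rewrite oner_eq0. Qed.

Lemma measurable_gpdf : measurable_fun [set: R] gpdf.
Proof. exact: measurable_normal_pdf. Qed.

Lemma integral_gpdf : (\int[mu]_x (gpdf x)%:E = 1)%E.
Proof. exact: integral_normal_pdf. Qed.

(** The formula holds with the Radon-Nikodym derivative of the Gaussian law in
    place of [gpdf], and the two agree almost everywhere because they have the same
    integral over every measurable set. *)
Lemma ge0_integral_gauss (h : R -> \bar R) : measurable_fun [set: R] h ->
  (forall x, 0 <= h x)%E ->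
  (\int[gauss]_x h x = \int[mu]_x (h x * (gpdf x)%:E))%E.
Proof.
move=> mh h0.
have dom : (gauss : probability _ _) `<< mu by exact: normal_prob_dominates.
rewrite -(Radon_Nikodym_SigmaFinite.change_of_variables dom)//.
apply: ae_eq_integral => //.
- apply: emeasurable_funM => //.
  by apply: measurable_int; exact: Radon_Nikodym_SigmaFinite.f_integrable.
- by apply: emeasurable_funM => //; apply/measurable_EFinP; exact: measurable_gpdf.
apply: ae_eqe_mul2l.
apply: integral_ae_eq => //.
- exact: Radon_Nikodym_SigmaFinite.f_integrable.
- by apply/measurable_EFinP; exact: measurable_gpdf.
- by move=> E _ mE; rewrite -Radon_Nikodym_SigmaFinite.f_integral.
Qed.

Lemma ge0_integral_gauss_shift (h : R -> \bar R) (a : R) :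
  measurable_fun [set: R] h -> (forall x, 0 <= h x)%E ->
  (\int[gauss]_n h (a + n)%R = \int[mu]_y (h y * (gpdf (y - a))%:E))%E.
Proof.
move=> mh h0.
have ma : measurable_fun [set: R] (fun n : R => a + n) by exact: measurable_funD.
rewrite (ge0_integral_gauss (measurableT_comp mh ma)); last by move=> x; exact: h0.
rewrite [RHS](@ge0_integral_affine _ 1 a)//.
- rewrite mul1e; apply: eq_integral => x _.
  by rewrite /= mul1r addrK [(a + x)%R]addrC.
- apply: emeasurable_funM => //; apply/measurable_EFinP.
  apply: measurableT_comp; first exact: measurable_gpdf.
  exact: measurable_funB.
- by move=> x; rewrite mule_ge0// lee_fin gpdf_ge0.
Qed.

(** The two arguments on each side are the coordinates of one point of the
    plane before and after a rotation, and the product of the two densities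
    depends only on the distance to the origin. *)
Lemma gpdf_rotation (c s n u : R) : 0 < s -> c ^+ 2 + s ^+ 2 = 1 ->
  gpdf n * gpdf ((u - c * n) / s) = gpdf u * gpdf ((n - c * u) / s).
Proof.
move=> s0 cs; rewrite !gpdfE mulrACA [RHS]mulrACA.
congr (_ * _); rewrite -!expRD; congr expR.
have s2 : s ^+ 2 != 0 by rewrite expf_neq0 ?gt_eqF.
have sE : s ^+ 2 = 1 - c ^+ 2 by rewrite -cs; ring.
have E : n ^+ 2 * s ^+ 2 + (u - c * n) ^+ 2 = u ^+ 2 * s ^+ 2 + (n - c * u) ^+ 2.
  by rewrite sE; ring.
rewrite !expr_div_n; apply: (mulIf s2); rewrite !mulrDl.
have D (x : R) : - (x / s ^+ 2 / 2) * s ^+ 2 = - (x / 2).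
  by field; rewrite gt_eqF.
rewrite !D; lra.
Qed.

(** For fixed [n], the change of variable [u = c * n + s * n'] turns the
    double integral into one against [gpdf n * gpdf ((u - c * n) / s) / s]; by
    [gpdf_rotation] the variable [n] then integrates out. *)
Lemma gauss_stable (h : R -> \bar R) (c s : R) : 0 < s -> c ^+ 2 + s ^+ 2 = 1 ->
  measurable_fun [set: R] h -> (forall x, 0 <= h x)%E ->
  (\int[gauss]_n \int[gauss]_n' h (c * n + s * n')%R = \int[gauss]_u h u)%E.
Proof.
move=> s0 cs mh h0.
have s'0 : 0 < s^-1 by rewrite invr_gt0.
pose k (n u : R) := s^-1 * (gpdf n * gpdf ((u - c * n) / s)).
have kC (n u : R) : k n u = s^-1 * (gpdf u * gpdf ((n - c * u) / s)).
  by rewrite /k (@gpdf_rotation c s).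
have k0 n u : 0 <= k n u by rewrite !mulr_ge0 ?gpdf_ge0// ltW.
have mk : measurable_fun [set: R * R] (fun z => k z.1 z.2).
  apply: measurable_funM => //; apply: measurable_funM.
    by apply: measurableT_comp => //; exact: measurable_gpdf.
  apply: measurableT_comp; first exact: measurable_gpdf.
  apply: measurable_funM => //; apply: measurable_funB => //.
  exact: measurable_funM.
have mk1 u : measurable_fun [set: R] (k ^~ u).
  exact: (measurableT_comp mk (pair2_measurable u)).
have maff1 n : measurable_fun [set: R] (fun x : R => c * n + s * x).
  by apply: measurable_funD => //; exact: measurable_funM.
have maff2 n : measurable_fun [set: R]
    (fun x : R => c * n + s * (s^-1 * x + - (c * n / s))).
  apply: (measurableT_comp (maff1 n)); exact: measurable_affine.
have inner (n : R) : (\int[gauss]_n' h (c * n + s * n')%R * (gpdf n)%:E =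
    \int[mu]_u (h u * (k n u)%:E))%E.
  rewrite (ge0_integral_gauss (measurableT_comp mh (maff1 n))); last first.
    by move=> x; exact: h0.
  rewrite -ge0_integralZr//=; last 3 first.
  - apply: emeasurable_funM; last by apply/measurable_EFinP; exact: measurable_gpdf.
    exact: (measurableT_comp mh (maff1 n)).
  - by move=> x _; rewrite mule_ge0// lee_fin gpdf_ge0.
  - by rewrite lee_fin gpdf_ge0.
  rewrite [LHS](@ge0_integral_affine _ s^-1 (- (c * n / s)))//.
  - rewrite -ge0_integralZl//=; last 3 first.
    + apply: emeasurable_funM; first apply: emeasurable_funM.
      * by apply: (measurableT_comp mh); exact: maff2.
      * apply: measurable_gpdf_comp; exact: measurable_affine.
      * exact: measurable_gpdf_comp.
    + by move=> x _; rewrite !mule_ge0// lee_fin gpdf_ge0.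
    + by rewrite lee_fin ltW.
    apply: eq_integral => u _.
    have -> : (c * n + s * (s^-1 * u - c * n / s))%R = u.
      by field; rewrite gt_eqF.
    rewrite muleCA -muleA; congr (_ * _)%E; rewrite -!EFinM; congr EFin.
    have -> : (s^-1 * u - c * n / s = (u - c * n) / s)%R.
      by field; rewrite gt_eqF.
    by rewrite /k; ring.
  - apply: emeasurable_funM; last exact: measurable_gpdf_comp.
    apply: emeasurable_funM; last exact: measurable_gpdf_comp.
    by apply: (measurableT_comp mh); exact: maff1.
  - by move=> x; rewrite !mule_ge0// lee_fin gpdf_ge0.
rewrite ge0_integral_gauss//=; last 2 first.
- apply: (@measurable_fun_fubini_tonelli_F _ _ _ _ _ gauss
    (fun z => h (c * z.1 + s * z.2)%R)) => [|z]; last exact: h0.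
  apply: (measurableT_comp mh).
  by apply: measurable_funD => //; exact: measurable_funM.
- by move=> x; exact: integral_ge0.
under eq_integral do rewrite inner.
rewrite (@fubini_tonelli _ _ _ _ _ mu mu (fun z => h z.2 * (k z.1 z.2)%:E)%E)//=.
- rewrite ge0_integral_gauss//; apply: eq_integral => u _.
  rewrite ge0_integralZl//=; last first.
  + by move=> n _; rewrite lee_fin.
  + by apply/measurable_EFinP; exact: mk1.
  congr (_ * _)%E.
  under eq_integral do rewrite kC mulrCA EFinM.
  rewrite ge0_integralZl//=; last 3 first.
  + apply/measurable_EFinP/measurable_funM => //.
    apply/measurable_EFinP/measurable_gpdf_comp.
    by apply: measurable_funM => //; exact: measurable_funB.
  + by move=> n _; rewrite lee_fin mulr_ge0 ?gpdf_ge0// ltW.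
  + by rewrite lee_fin gpdf_ge0.
  rewrite -[RHS]mule1; congr (_ * _)%E.
  rewrite -integral_gpdf [RHS](@ge0_integral_affine _ s^-1 (- (c * u / s)))//.
  + rewrite -ge0_integralZl; last 4 first.
    * by [].
    * apply: measurable_gpdf_comp; exact: measurable_affine.
    * by move=> x _; rewrite lee_fin gpdf_ge0.
    * by rewrite lee_fin ltW.
    apply: eq_integral => n _; rewrite EFinM; congr (_ * (gpdf _)%:E)%E.
    by field; rewrite gt_eqF.
  + by apply/measurable_EFinP; exact: measurable_gpdf.
  + by move=> x; rewrite lee_fin gpdf_ge0.
- apply: emeasurable_funM; first exact: measurableT_comp.
  exact/measurable_EFinP.
- by move=> z; rewrite mule_ge0// lee_fin.
Qed.
(** Half of the exponent absorbs the square, as [x ^+ 2 / 4] is below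
    [expR (x ^+ 2 / 4)]; the other half is a Gaussian of variance 2. *)
Lemma sqr_gpdf_le (x : R) : x ^+ 2 * gpdf x <=
  4 * normal_peak 1 / normal_peak (Num.sqrt 2) * normal_pdf 0 (Num.sqrt 2) x.
Proof.
have s20 : Num.sqrt 2 != 0 :> R by rewrite sqrtr_eq0 -ltNge.
have p2 : 0 < normal_peak (Num.sqrt 2) :> R by exact: normal_peak_gt0.
rewrite gpdfE normal_pdfE// /normal_fun subr0 sqr_sqrtr// mulNr.
have -> : 2 *+ 2 = 4 :> R by lra.
(* the normalizing constants of variance 1 and 2 cancel *)
have -> : 4 * normal_peak 1 / normal_peak (Num.sqrt 2) *
    (normal_peak (Num.sqrt 2) * expR (- (x ^+ 2 / 4))) =
    normal_peak 1 * (4 * expR (- (x ^+ 2 / 4))) :> R.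
  by field; rewrite gt_eqF.
rewrite mulrCA; apply: ler_wpM2l; first exact: normal_peak_ge0.
have -> : - (x ^+ 2 / 2) = - (x ^+ 2 / 4) + - (x ^+ 2 / 4) by lra.
rewrite expRD mulrA; apply: ler_wpM2r; first exact: expR_ge0.
have := expR_ge1Dx (x ^+ 2 / 4) => e.
have e0 := expR_gt0 (x ^+ 2 / 4).
rewrite expRN ler_pdivrMr//; lra.
Qed.

Lemma integral_gauss_sqr_lty : (\int[gauss]_x (x ^+ 2)%:E < +oo)%E.
Proof.
rewrite (@ge0_integral_gauss (fun x => (x ^+ 2)%:E)); last 2 first.
- by apply/measurable_EFinP; exact: measurable_funX.
- by move=> x; rewrite lee_fin sqr_ge0.
pose C : R := 4 * normal_peak 1 / normal_peak (Num.sqrt 2).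
apply: (@le_lt_trans _ _ (\int[mu]_x (C%:E * (normal_pdf 0 (Num.sqrt 2) x)%:E))%E).
  apply: ge0_le_integral => //.
  - by move=> x _; rewrite -EFinM lee_fin mulr_ge0 ?sqr_ge0 ?gpdf_ge0.
  - apply: emeasurable_funM; last exact: measurable_gpdf_comp.
    by apply/measurable_EFinP; exact: measurable_funX.
  - apply: emeasurable_funM => //; apply/measurable_EFinP; exact: measurable_normal_pdf.
  - by move=> x _; rewrite -!EFinM lee_fin; exact: sqr_gpdf_le.
rewrite ge0_integralZl//; last 3 first.
- by apply/measurable_EFinP; exact: measurable_normal_pdf.
- by move=> x _; rewrite lee_fin normal_pdf_ge0.
- by rewrite lee_fin !mulr_ge0 ?invr_ge0 ?normal_peak_ge0.
by rewrite integral_normal_pdf mule1 ltry.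
Qed.
End standard_gaussian.

(** * Integrals of real-valued functions *)

Section real_integrable.
Context {R : realType} d (T : measurableType d) (m : {measure set T -> \bar R}).

Lemma integrable_scale (c : R) (h : T -> R) : m.-integrable setT (fun x => (h x)%:E) ->
  m.-integrable setT (fun x => (c * h x)%:E).
Proof. by move=> ih; have := integrableZl measurableT c ih; apply: eq_integrable. Qed.

Lemma integrable_add (h k : T -> R) : m.-integrable setT (fun x => (h x)%:E) ->
  m.-integrable setT (fun x => (k x)%:E) -> m.-integrable setT (fun x => (h x + k x)%:E).
Proof. by move=> ih ik; have := integrableD measurableT ih ik; apply: eq_integrable. Qed.

Lemma integrable_sub (h k : T -> R) : m.-integrable setT (fun x => (h x)%:E) ->
  m.-integrable setT (fun x => (k x)%:E) -> m.-integrable setT (fun x => (h x - k x)%:E).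
Proof. by move=> ih ik; have := integrableB measurableT ih ik; apply: eq_integrable. Qed.

Lemma integrable_dominated (h k : T -> R) : measurable_fun setT h ->
  m.-integrable setT (fun x => (k x)%:E) -> (forall x, `|h x| <= k x) ->
  m.-integrable setT (fun x => (h x)%:E).
Proof.
move=> mh ik hk; apply: le_integrable ik => //; first exact/measurable_EFinP.
by move=> x _ /=; rewrite lee_fin (le_trans (hk x))// ler_norm.
Qed.

Lemma integrable_sqr (f : T -> R) : measurable_fun setT f ->
  (\int[m]_x (f x ^+ 2)%:E < +oo)%E ->
  m.-integrable setT (fun x => (f x ^+ 2)%:E).
Proof.
move=> mf fy; apply/integrableP; split.
  by apply/measurable_EFinP; exact: measurable_funX.
by under eq_integral do rewrite /= ger0_norm ?sqr_ge0//.
Qed.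

Lemma integrableM_sqr (f g : T -> R) :
  measurable_fun setT f -> measurable_fun setT g ->
  m.-integrable setT (fun w => (f w ^+ 2)%:E) ->
  m.-integrable setT (fun w => (g w ^+ 2)%:E) ->
  m.-integrable setT (fun w => (f w * g w)%:E).
Proof.
move=> mf mg if2 ig2.
apply: (@integrable_dominated _ (fun w => f w ^+ 2 + g w ^+ 2)).
- exact: measurable_funM.
- exact: integrable_add.
- move=> w; rewrite normrM.
  have := sqr_ge0 (`|f w| - `|g w|); rewrite sqrrB -mulr_natl !real_normK ?num_real//.
  have := sqr_ge0 (f w); have := sqr_ge0 (g w); lra.
Qed.
End real_integrable.

Lemma integrable_of_sqr (R : realType) d (T : measurableType d)
    (Q : probability T R) (f : T -> R) : measurable_fun setT f ->
  Q.-integrable setT (fun x => (f x ^+ 2)%:E) ->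
  Q.-integrable setT (fun x => (f x)%:E).
Proof.
move=> mf if2.
apply: (@integrable_dominated _ _ _ Q _ (fun x => 1 + f x ^+ 2)) => //.
  by apply: integrable_add => //; exact: finite_measure_integrable_cst.
move=> x; have := sqr_ge0 (`|f x| - 1).
rewrite sqrrB expr1n mulr1 real_normK ?num_real//.
have := normr_ge0 (f x); have := sqr_ge0 (f x); lra.
Qed.

(** An identity of integrals known for nonnegative functions extends to
    integrable ones through positive and negative parts. It is used twice: to
    pass from the channel to the density of its output, and to replace the noise
    by a rotated one. *)
Section density_transfer.
Context {R : realType} d1 d2 (T1 : measurableType d1) (T2 : measurableType d2).
Context (m1 : {measure set T1 -> \bar R}) (m2 : {measure set T2 -> \bar R}).
Context (phi : T1 -> T2) (rho : T2 -> R).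
Hypothesis mrho : measurable_fun [set: T2] rho.
Hypothesis rho0 : forall z, 0 <= rho z.
Hypothesis ge0_transfer : forall F : T2 -> \bar R,
  measurable_fun [set: T2] F -> (forall z, 0 <= F z)%E ->
  (\int[m1]_w F (phi w) = \int[m2]_z (F z * (rho z)%:E))%E.

Lemma integral_transfer (F : T2 -> R) : measurable_fun [set: T2] F ->
  m1.-integrable [set: T1] (fun w => (F (phi w))%:E) ->
  m2.-integrable [set: T2] (fun z => (F z * rho z)%:E) /\
  (\int[m1]_w (F (phi w))%:E = \int[m2]_z (F z * rho z)%:E)%E.
Proof.
move=> mF /integrableP[_ iF].
have mEF : measurable_fun [set: T2] (EFin \o F) by exact/measurable_EFinP.
split.
  apply/integrableP; split.
    by apply/measurable_EFinP; exact: measurable_funM.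
  move: iF; rewrite (ge0_transfer (F := fun z => `|(F z)%:E|%E)); last 2 first.
  - exact: (measurableT_comp _ mEF).
  - by move=> z; exact: abse_ge0.
  congr (_ < _)%E; apply: eq_integral => z _.
  by rewrite EFinM abseM [X in (_ = _ * X)%E]gee0_abs// lee_fin.
rewrite integralE [RHS]integralE; congr (_ - _)%E.
- transitivity (\int[m2]_z ((EFin \o F)^\+ z * (rho z)%:E))%E.
    rewrite -ge0_transfer; [|exact: measurable_funepos|move=> z; exact: funepos_ge0].
    by apply: eq_integral => w _; rewrite !funeposE.
  apply: eq_integral => z _; rewrite !funeposE/= EFinM -[in RHS](mul0e (rho z)%:E).
  by rewrite maxeMl// lee_fin.
- transitivity (\int[m2]_z ((EFin \o F)^\- z * (rho z)%:E))%E.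
    rewrite -ge0_transfer; [|exact: measurable_funeneg|move=> z; exact: funeneg_ge0].
    by apply: eq_integral => w _; rewrite !funenegE.
  apply: eq_integral => z _.
  rewrite !funenegE/= !EFinN EFinM -[in RHS](mul0e (rho z)%:E) -mulNe.
  by rewrite maxeMl// lee_fin.
Qed.
End density_transfer.

Lemma lt_limn_einf_near (R : realType) (u : (\bar R)^nat) (c : \bar R) :
  (c < limn_einf u)%E -> \forall n \near \oo, (c < u n)%E.
Proof.
have -> : limn_einf u = ereal_sup (range (einfs u)).
  by rewrite limn_einf_lim; apply/cvg_lim => //; exact: cvg_einfs_sup.
move=> /ereal_sup_gt[_ [m _ <-] cm].
near=> n; apply: (lt_le_trans cm); apply: ereal_inf_lbound.
by exists n => //=; near: n; exists m.
Unshelve. all: by end_near. Qed.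

(** Fatou's lemma for real integrands that converge pointwise, in the form
    of lower semicontinuity of the integrals. *)
Lemma fatou_near (R : realType) d (T : measurableType d)
    (m : {measure set T -> \bar R}) (F : nat -> T -> R) (G : T -> R)
    (u : nat -> R) (l c : R) :
  (forall n, measurable_fun setT (F n)) -> (forall n x, 0 <= F n x) ->
  (forall x, F n x @[n --> \oo] --> G x) ->
  (forall n, \int[m]_x (F n x)%:E = (u n)%:E)%E ->
  (\int[m]_x (G x)%:E = l%:E)%E -> c < l -> \forall n \near \oo, c < u n.
Proof.
move=> mF F0 FG Fu Gl cl.
have h : (c%:E < limn_einf (fun n => (u n)%:E))%E.
  apply: (@lt_le_trans _ _ l%:E); first by rewrite lte_fin.
  rewrite -Gl.
  have := @fatou _ _ _ m setT measurableT (fun n x => (F n x)%:E) _ _.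
  rewrite (_ : (fun n => \int[m]_x (F n x)%:E)%E = fun n => (u n)%:E);
    last exact/funext.
  rewrite (eq_integral (fun x => (G x)%:E)); last first.
    move=> x _; apply: (cvg_limn_einf_sup _).1.
    by apply: cvg_EFin; [exact: nearW|exact: FG].
  apply.
  - by move=> n; exact/measurable_EFinP.
  - by move=> n x _; rewrite lee_fin.
by have := lt_limn_einf_near h; apply: filterS => n; rewrite lte_fin.
Qed.

(** * The channel law as a density *)

Section channel.
Context {R : realType}.
Local Notation mu := (@lebesgue_measure R).
Local Notation gauss := (normal_prob (0:R) 1 : probability (measurableTypeR R) R).
Local Notation RR := (measurableTypeR R * measurableTypeR R)%type.
Context (pi : probability (measurableTypeR R) R).
Local Notation P := (channel_prob pi).

(** The conditional density of the output at [y] given the input [x]; [t] is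
    the square root of the signal-to-noise ratio, so that densities are smooth
    in it. *)
Definition lik (t x y : R) : R := gpdf (y - t * x).

Lemma lik_gt0 t x y : 0 < lik t x y. Proof. exact: gpdf_gt0. Qed.
Lemma lik_ge0 t x y : 0 <= lik t x y. Proof. exact: gpdf_ge0. Qed.

Lemma measurable_lik t :
  measurable_fun [set: RR] (fun z : RR => (lik t z.1 z.2)%:E).
Proof.
apply: measurable_gpdf_comp; apply: measurable_funB => //.
exact: measurable_funM.
Qed.

Lemma measurable_likl t y :
  measurable_fun [set: measurableTypeR R] (fun x => (lik t x y)%:E).
Proof. exact: (measurableT_comp (@measurable_lik t) (pair2_measurable y)). Qed.

Definition transmit (t : R) (w : RR) : RR := (w.1, t * w.1 + w.2).

Lemma measurable_transmit t : measurable_fun [set: RR] (transmit t).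
Proof.
apply: measurable_fun_pair => //; apply: measurable_funD => //.
exact: measurable_funM.
Qed.

Lemma measurable_output t :
  measurable_fun [set: RR] (fun w : RR => t * w.1 + w.2).
Proof. by apply: measurable_funD => //; exact: measurable_funM. Qed.

(** For a given input, adding the signal to the noise translates the Gaussian
    density by [t * x]. *)
Lemma ge0_integral_channel t (F : RR -> \bar R) :
  measurable_fun [set: RR] F -> (forall z, 0 <= F z)%E ->
  (\int[P]_w F (transmit t w) = \int[pi \x mu]_z (F z * (lik t z.1 z.2)%:E))%E.
Proof.
move=> mF F0.
rewrite /channel_prob fubini_tonelli1; last 2 first.
- exact: (measurableT_comp mF (measurable_transmit t)).
- by move=> w; exact: F0.
rewrite fubini_tonelli1; last 2 first.
- by apply: emeasurable_funM => //; exact: measurable_lik.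
- by move=> z; rewrite mule_ge0// lee_fin lik_ge0.
apply: eq_integral => x _; rewrite /fubini_F/=.
rewrite (@ge0_integral_gauss_shift _ (fun y => F (x, y)) (t * x))//.
exact: (measurableT_comp mF (pair1_measurable x)).
Qed.

Lemma integral_channel t (F : RR -> R) : measurable_fun [set: RR] F ->
  P.-integrable [set: RR] (fun w => (F (transmit t w))%:E) ->
  (pi \x mu)%E.-integrable [set: RR] (fun z => (F z * lik t z.1 z.2)%:E) /\
  (\int[P]_w (F (transmit t w))%:E =
   \int[pi \x mu]_z (F z * lik t z.1 z.2)%:E)%E.
Proof.
apply: integral_transfer.
- by apply/measurable_EFinP; exact: measurable_lik.
- by move=> z; exact: lik_ge0.
- exact: ge0_integral_channel.
Qed.
End channel.

(** * Output density and posterior mean *)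

Section output_density.
Context {R : realType}.
Local Notation mu := (@lebesgue_measure R).
Local Notation RR := (measurableTypeR R * measurableTypeR R)%type.
Context (pi : probability (measurableTypeR R) R).

(** An unnormalized posterior moment: divided by the output density, it is the
    conditional mean of [h] of the input given the output [y]. *)
Definition lik_moment (h : R -> R) (t y : R) : R := \int[pi]_x (h x * lik t x y).

Definition outpdf (t y : R) : R := lik_moment (cst 1) t y.
Definition postmean (t y : R) : R := lik_moment id t y / outpdf t y.

Lemma integrable_gpdf_comp (h phi : R -> R) :
  pi.-integrable setT (EFin \o h) -> measurable_fun [set: R] phi ->
  pi.-integrable setT (fun x => (h x * gpdf (phi x))%:E).
Proof.
move=> ih mphi; have mh := measurable_int _ ih.
apply: (@integrable_dominated _ _ _ pi _ (fun x => normal_peak 1 * `|h x|)).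
- by apply: measurable_funM; apply/measurable_EFinP => //; exact: measurable_gpdf_comp.
- by apply: integrable_scale; exact: integrable_norm.
- move=> x /=; rewrite normrM mulrC; apply: ler_wpM2r => //.
  by rewrite ger0_norm ?gpdf_ge0// gpdf_le.
Qed.

(** Dominated convergence: the Gaussian density is bounded, so a multiple of
    the absolute value of [h] dominates, whatever the parameter. *)
Lemma continuous_integral_gpdf (h : R -> R) (phi : R -> R -> R) :
  pi.-integrable setT (EFin \o h) ->
  (forall l, measurable_fun [set: R] (phi l)) ->
  (forall x, continuous (phi ^~ x)) ->
  continuous (fun l => \int[pi]_x (h x * gpdf (phi l x))).
Proof.
move=> ih mphi cphi a.
apply: (@continuity_under_integral _ _ _ pi (fun l x => h x * gpdf (phi l x))
   setT measurableT (a - 1) (a + 1) _ _ (fun x => normal_peak 1 * `|h x|)).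
- by move=> l _; exact: integrable_gpdf_comp.
- apply: aeW => x _ l _; apply: cvgM; first exact: cvg_cst.
  apply: (continuous_comp (cphi x l)); exact: continuous_gpdf.
- by apply: integrable_scale; exact: integrable_norm.
- move=> l _; apply: aeW => x _; rewrite normrM mulrC; apply: ler_wpM2r => //.
  by rewrite ger0_norm ?gpdf_ge0// gpdf_le.
- by rewrite inE/= in_itv/=; apply/andP; split; lra.
Qed.

Lemma measurable_shift t y : measurable_fun [set: R] (fun x : R => y - t * x).
Proof. by apply: measurable_funB => //; exact: measurable_funM. Qed.

Lemma integrable_lik (h : R -> R) t y : pi.-integrable setT (EFin \o h) ->
  pi.-integrable setT (fun x => (h x * lik t x y)%:E).
Proof. by move=> ih; apply: integrable_gpdf_comp => //; exact: measurable_shift. Qed.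

Lemma continuous_lik_momentr (h : R -> R) t : pi.-integrable setT (EFin \o h) ->
  continuous (lik_moment h t).
Proof.
move=> ih; apply: continuous_integral_gpdf => // [y|x y].
  exact: measurable_shift.
by apply: cvgB => //; exact: cvg_cst.
Qed.

Lemma continuous_lik_momentl (h : R -> R) y : pi.-integrable setT (EFin \o h) ->
  continuous (fun t => lik_moment h t y).
Proof.
move=> ih.
apply: (@continuous_integral_gpdf h (fun t x => y - t * x)) => // [t|x t].
  exact: measurable_shift.
by apply: cvgB; [exact: cvg_cst|apply: cvgM; [exact: cvg_id|exact: cvg_cst]].
Qed.

Lemma measurable_lik_moment (h : R -> R) t : pi.-integrable setT (EFin \o h) ->
  measurable_fun [set: R] (lik_moment h t).
Proof.
by move=> ih; apply: continuous_measurable_fun; exact: continuous_lik_momentr.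
Qed.

Lemma lik_momentE (h : R -> R) t y : pi.-integrable setT (EFin \o h) ->
  ((lik_moment h t y)%:E = \int[pi]_x (h x * lik t x y)%:E)%E.
Proof.
move=> ih; rewrite /lik_moment /Rintegral fineK//.
exact: integrable_fin_num (integrable_lik _ _ ih).
Qed.

Lemma lik_momentD (h k : R -> R) t y : pi.-integrable setT (EFin \o h) ->
  pi.-integrable setT (EFin \o k) ->
  lik_moment (fun x => h x + k x) t y = lik_moment h t y + lik_moment k t y.
Proof.
move=> ih ik; rewrite /lik_moment -RintegralD//; last 2 first.
- exact: integrable_lik.
- exact: integrable_lik.
by apply: eq_Rintegral => x _; rewrite mulrDl.
Qed.

Lemma lik_momentZ (h : R -> R) c t y : pi.-integrable setT (EFin \o h) ->
  lik_moment (fun x => c * h x) t y = c * lik_moment h t y.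
Proof.
move=> ih; rewrite /lik_moment -RintegralZl//; last exact: integrable_lik.
by apply: eq_Rintegral => x _; rewrite mulrA.
Qed.

Lemma le_lik_moment (h k : R -> R) t y : pi.-integrable setT (EFin \o h) ->
  pi.-integrable setT (EFin \o k) -> (forall x, h x <= k x) ->
  lik_moment h t y <= lik_moment k t y.
Proof.
move=> ih ik hk; apply: le_Rintegral => //.
- exact: integrable_lik.
- exact: integrable_lik.
- by move=> x _; apply: ler_wpM2r => //; exact: lik_ge0.
Qed.

Lemma integrable_cst_pi (c : R) : pi.-integrable setT (EFin \o cst c).
Proof. exact: finite_measure_integrable_cst. Qed.

Lemma likE (t x y : R) : lik t x y = normal_peak 1 * expR (- ((y - t * x) ^+ 2 / 2)).
Proof. exact: gpdfE. Qed.

(** The quadratic terms in the input cancel in the ratio of two likelihoods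
    with the same input: moving the output tilts the likelihood exponentially. *)
Lemma lik_tilt (t x y y' : R) : lik t x y' =
  lik t x y * expR (- ((y' ^+ 2 - y ^+ 2) / 2) + t * x * (y' - y)).
Proof. by rewrite !likE -[RHS]mulrA -expRD; congr (_ * expR _); field. Qed.

Lemma expR_tangent (u c : R) : expR c * (1 + (u - c)) <= expR u.
Proof.
have -> : u = c + (u - c) by ring.
rewrite expRD; apply: ler_wpM2l; first exact: expR_ge0.
by apply: le_trans (expR_ge1Dx _); rewrite le_eqVlt; apply/orP; left; apply/eqP; ring.
Qed.

Hypothesis mean0 : (\int[pi]_x x%:E = 0)%E.
Hypothesis sqr1 : (\int[pi]_x (x ^+ 2)%:E = 1)%E.

Lemma integrable_sqr_pi : pi.-integrable setT (EFin \o (fun x : R => x ^+ 2)).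
Proof. by apply: integrable_sqr => //; rewrite sqr1 ltry. Qed.

Lemma integrable_id_pi : pi.-integrable setT (EFin \o (fun x : R => x)).
Proof. by apply: integrable_of_sqr; last exact: integrable_sqr_pi. Qed.

Let i1 := integrable_cst_pi.
Let iX := integrable_id_pi.
Let iX2 := integrable_sqr_pi.

Lemma integrable_affine_pi a b : pi.-integrable setT (EFin \o (fun x : R => a + b * x)).
Proof. by apply: integrable_add; [exact: i1|exact: integrable_scale]. Qed.

(** Jensen's inequality for the exponential, through its tangent at the mean
    exponent: that mean is minus half of [y ^+ 2 + t ^+ 2], the input having mean
    0 and variance 1. *)
Lemma outpdf_ge t y : normal_peak 1 * expR (- ((y ^+ 2 + t ^+ 2) / 2)) <= outpdf t y.
Proof.
set c := - ((y ^+ 2 + t ^+ 2) / 2).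
(* tangent line of the exponential at c, as a function of the exponent *)
pose k x := normal_peak 1 * expR c * (1 + (- ((y - t * x) ^+ 2 / 2) - c)).
pose k' x := normal_peak 1 * expR c * (1 + t ^+ 2 / 2) +
  normal_peak 1 * expR c * y * t * x +
  - (normal_peak 1 * expR c * t ^+ 2 / 2) * x ^+ 2.
have kk' : k = k' by apply/funext => x; rewrite /k /k' /c; field.
have ik' : pi.-integrable setT (EFin \o k').
  by apply: integrable_add; [exact: integrable_affine_pi|exact: integrable_scale].
have kl x : k x <= lik t x y.
  rewrite likE /k -mulrA; apply: ler_wpM2l; first exact: normal_peak_ge0.
  exact: expR_tangent.
apply: (@le_trans _ _ (\int[pi]_x k x)).
  rewrite kk' /k'.
  rewrite RintegralD//=; last 2 first.
  - exact: integrable_affine_pi.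
  - exact: integrable_scale.
  rewrite RintegralD//=; last 2 first.
  - exact: i1.
  - exact: integrable_scale.
  rewrite Rintegral_cst// [X in fine X](@probability_setT _ _ _ pi) /= mulr1.
  rewrite RintegralZl// RintegralZl// /Rintegral mean0 sqr1/= mulr0 mulr1.
  by rewrite le_eqVlt; apply/orP; left; apply/eqP; field.
rewrite /outpdf /lik_moment; apply: le_Rintegral => //.
- by rewrite kk'.
- exact: integrable_lik.
- by move=> x _; rewrite /= mul1r.
Qed.

Lemma outpdf_gt0 t y : 0 < outpdf t y.
Proof.
apply: lt_le_trans (outpdf_ge t y).
by rewrite mulr_gt0 ?expR_gt0// normal_peak_gt0 ?oner_eq0.
Qed.

Lemma outpdf_le t y : outpdf t y <= normal_peak 1.
Proof.
apply: (@le_trans _ _ (\int[pi]_x (cst (normal_peak 1 : R) x))).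
  apply: le_Rintegral => //; first exact: integrable_lik.
  by move=> x _; rewrite /= mul1r gpdf_le.
by rewrite Rintegral_cst// [X in fine X](@probability_setT _ _ _ pi) /= mulr1.
Qed.

Lemma lik_moment_id t y : lik_moment id t y = postmean t y * outpdf t y.
Proof. by rewrite /postmean divfK// gt_eqF// outpdf_gt0. Qed.

Lemma lik_moment_affine a b t y :
  lik_moment (fun x => a + b * x) t y = (a + b * postmean t y) * outpdf t y.
Proof.
rewrite (@lik_momentD (cst a) (fun x => b * x)) ?(@lik_momentZ (fun x => x))//.
rewrite ?lik_moment_id.
- rewrite (_ : cst a = (fun x => a * cst 1 x)); last first.
    by apply/funext => x; rewrite /= mulr1.
  by rewrite lik_momentZ// /outpdf; ring.
- exact: integrable_scale.
Qed.

(** After the Gaussian factor is taken out, the logarithm of the output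
    density is the cumulant generating function of the posterior law, hence
    convex, with slope [t] times the posterior mean. The inequality is its tangent
    at [y], proved by bounding the exponential tilt of [lik_tilt] below by a
    tangent and averaging. *)
Lemma outpdf_tangent t y y' :
  outpdf t y * expR (- ((y' ^+ 2 - y ^+ 2) / 2) + t * postmean t y * (y' - y)) <=
  outpdf t y'.
Proof.
(* c is the posterior mean of the tilting exponent u below *)
set c := _ + _.
pose u x := - ((y' ^+ 2 - y ^+ 2) / 2) + t * x * (y' - y).
pose k x := expR c * (1 - t * postmean t y * (y' - y)) + expR c * t * (y' - y) * x.
have kE x : k x = expR c * (1 + (u x - c)) by rewrite /k /u /c; ring.
apply: (@le_trans _ _ (lik_moment k t y)).
  rewrite lik_moment_affine le_eqVlt; apply/orP; left; apply/eqP; ring.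
rewrite /outpdf /lik_moment; apply: le_Rintegral => //.
- exact: (integrable_lik _ _ (integrable_affine_pi _ _)).
- exact: integrable_lik.
- move=> x _; rewrite /= mul1r (lik_tilt t x y y') mulrC; apply: ler_wpM2l.
    exact: lik_ge0.
  by rewrite kE; exact: expR_tangent.
Qed.

(** The Cauchy-Schwarz inequality for the posterior law, as the mean of the
    square of the distance to the posterior mean is nonnegative. *)
Lemma sqr_postmean_le t y :
  postmean t y ^+ 2 * outpdf t y <= lik_moment (fun x => x ^+ 2) t y.
Proof.
set m := postmean t y.
pose k x := - m ^+ 2 + 2 * m * x.
have : lik_moment k t y <= lik_moment (fun x => x ^+ 2) t y.
  apply: le_lik_moment => //; first exact: integrable_affine_pi.
  by move=> x; rewrite /k; have := sqr_ge0 (x - m); rewrite sqrrB -mulr_natl; lra.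
rewrite lik_moment_affine -/m; apply: le_trans.
by rewrite le_eqVlt; apply/orP; left; apply/eqP; ring.
Qed.
End output_density.

(** * Expectations over the channel *)

Section channel_expectation.
Context {R : realType}.
Local Notation mu := (@lebesgue_measure R).
Local Notation gauss := (normal_prob (0:R) 1 : probability (measurableTypeR R) R).
Local Notation RR := (measurableTypeR R * measurableTypeR R)%type.
Context (pi : probability (measurableTypeR R) R).
Local Notation P := (channel_prob pi).
Hypothesis mean0 : (\int[pi]_x x%:E = 0)%E.
Hypothesis sqr1 : (\int[pi]_x (x ^+ 2)%:E = 1)%E.

Lemma measurable_output_comp (phi : R -> R) t : measurable_fun [set: R] phi ->
  measurable_fun [set: RR] (fun w : RR => phi (t * w.1 + w.2)).
Proof. by move=> mphi; apply: (measurableT_comp mphi); exact: measurable_output. Qed.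

Lemma ge0_integral_input_output (h phi : R -> R) t :
  pi.-integrable setT (EFin \o h) -> (forall x, 0 <= h x) ->
  measurable_fun [set: R] phi -> (forall y, 0 <= phi y) ->
  (\int[P]_w (h w.1 * phi (t * w.1 + w.2)%R)%:E =
   \int[mu]_y (phi y * lik_moment pi h t y)%:E)%E.
Proof.
move=> ih h0 mphi phi0; have mh : measurable_fun [set: R] h.
  by apply/measurable_EFinP; exact: measurable_int ih.
have mF : measurable_fun [set: RR] (fun z : RR => (h z.1 * phi z.2)%:E).
  apply/measurable_EFinP; apply: measurable_funM.
    by apply: (measurableT_comp mh).
  by apply: (measurableT_comp mphi).
rewrite (ge0_integral_channel pi t mF); last first.
  by move=> z; rewrite lee_fin mulr_ge0.
have mFl : measurable_fun [set: RR]
    (fun z : RR => ((h z.1 * phi z.2)%:E * (lik t z.1 z.2)%:E)%E).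
  by apply: emeasurable_funM mF (measurable_lik t).
have Fl0 (z : RR) : (0 <= (h z.1 * phi z.2)%:E * (lik t z.1 z.2)%:E)%E.
  by rewrite mule_ge0// lee_fin ?mulr_ge0 ?lik_ge0.
rewrite (fubini_tonelli1 _ mFl Fl0) (fubini_tonelli _ mFl Fl0).
apply: eq_integral => y _; rewrite EFinM lik_momentE//.
rewrite -ge0_integralZl//=; last 3 first.
- by apply: measurable_int; exact: integrable_lik ih.
- by move=> x _; rewrite lee_fin mulr_ge0// lik_ge0.
- by rewrite lee_fin.
by apply: eq_integral => x _; rewrite -!EFinM mulrCA mulrA.
Qed.

(** For integrable, possibly signed, integrands: the input is averaged first,
    which produces its unnormalized posterior moment. *)
Lemma integral_input_output (h phi : R -> R) t :
  pi.-integrable setT (EFin \o h) -> measurable_fun [set: R] phi ->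
  P.-integrable setT (fun w => (h w.1 * phi (t * w.1 + w.2))%:E) ->
  (\int[P]_w (h w.1 * phi (t * w.1 + w.2)%R)%:E =
   \int[mu]_y (phi y * lik_moment pi h t y)%:E)%E.
Proof.
move=> ih mphi iF; have mh : measurable_fun [set: R] h.
  by apply/measurable_EFinP; exact: measurable_int ih.
have mF : measurable_fun [set: RR] (fun z : RR => h z.1 * phi z.2).
  apply: measurable_funM.
    by apply: (measurableT_comp mh).
  by apply: (measurableT_comp mphi).
have [ifl ->] := integral_channel mF iF.
rewrite -(integral21_prod_meas1 ifl).
apply: eq_integral => y _; rewrite /fubini_G/= EFinM lik_momentE//.
rewrite -integralZl//=; last exact: integrable_lik.
by apply: eq_integral => x _; rewrite -!EFinM mulrCA mulrA.
Qed.

Lemma ge0_integral_output_ereal (phi : R -> \bar R) t :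
  measurable_fun [set: R] phi -> (forall y, 0 <= phi y)%E ->
  (\int[P]_w (phi (t * w.1 + w.2)%R) =
   \int[mu]_y (phi y * (outpdf pi t y)%:E))%E.
Proof.
move=> mphi phi0.
have mF : measurable_fun [set: RR] (fun z : RR => phi z.2).
  by apply: (measurableT_comp mphi).
rewrite (ge0_integral_channel pi t mF); last by move=> z; exact: phi0.
have mFl : measurable_fun [set: RR]
    (fun z : RR => (phi z.2 * (lik t z.1 z.2)%:E)%E).
  by apply: emeasurable_funM mF (measurable_lik t).
have Fl0 (z : RR) : (0 <= phi z.2 * (lik t z.1 z.2)%:E)%E.
  by rewrite mule_ge0// lee_fin ?mulr_ge0 ?lik_ge0.
rewrite (fubini_tonelli1 _ mFl Fl0) (fubini_tonelli _ mFl Fl0).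
apply: eq_integral => y _; rewrite /= ge0_integralZl//=; last 2 first.
- exact: measurable_likl.
- by move=> x _; rewrite lee_fin lik_ge0.
rewrite lik_momentE; last exact: integrable_cst_pi.
by congr (_ * _)%E; apply: eq_integral => x _; rewrite /= mul1r.
Qed.

Lemma ge0_integral_output (phi : R -> R) t :
  measurable_fun [set: R] phi -> (forall y, 0 <= phi y) ->
  (\int[P]_w (phi (t * w.1 + w.2)%R)%:E =
   \int[mu]_y (phi y * outpdf pi t y)%:E)%E.
Proof.
move=> mphi phi0; apply: (@ge0_integral_output_ereal (EFin \o phi)).
  exact/measurable_EFinP.
by move=> y; rewrite lee_fin; exact: phi0.
Qed.

Lemma ge0_integral_input (h : R -> \bar R) : measurable_fun [set: R] h ->
  (forall x, 0 <= h x)%E -> (\int[P]_w h w.1 = \int[pi]_x h x)%E.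
Proof.
move=> mh h0; rewrite (@fubini_tonelli1 _ _ _ _ _ pi gauss (fun w : RR => h w.1)).
- apply: eq_integral => x _; rewrite /fubini_F/= integral_cst//.
  by rewrite [X in (_ * X)%E](@probability_setT _ _ _ gauss) mule1.
- by apply: (measurableT_comp mh).
- by move=> w; exact: h0.
Qed.

Lemma ge0_integral_noise (h : R -> \bar R) : measurable_fun [set: R] h ->
  (forall x, 0 <= h x)%E -> (\int[P]_w h w.2 = \int[gauss]_x h x)%E.
Proof.
move=> mh h0; rewrite (@fubini_tonelli1 _ _ _ _ _ pi gauss (fun w : RR => h w.2)).
- rewrite /fubini_F/= integral_cst//.
  by rewrite [X in (_ * X)%E](@probability_setT _ _ _ pi) mule1.
- by apply: (measurableT_comp mh).
- by move=> w; exact: h0.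
Qed.

Lemma integral_input_sqr : (\int[P]_w (w.1 ^+ 2)%:E = 1)%E.
Proof.
rewrite -sqr1 (ge0_integral_input (h := fun x => (x ^+ 2)%:E))//.
- by apply/measurable_EFinP; exact: measurable_funX.
- by move=> x; rewrite lee_fin sqr_ge0.
Qed.

Lemma integrable_input_sqr : P.-integrable setT (fun w => (w.1 ^+ 2)%:E).
Proof. by apply: integrable_sqr => //; rewrite integral_input_sqr ltry. Qed.

Lemma integrable_noise_sqr : P.-integrable setT (fun w => (w.2 ^+ 2)%:E).
Proof.
apply: integrable_sqr => //.
rewrite (ge0_integral_noise (h := fun x => (x ^+ 2)%:E)).
- exact: integral_gauss_sqr_lty.
- by apply/measurable_EFinP; exact: measurable_funX.
- by move=> x; rewrite lee_fin sqr_ge0.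
Qed.

Lemma integrable_input_noise : P.-integrable setT (fun w => (w.1 * w.2)%:E).
Proof.
apply: integrableM_sqr => //.
- exact: integrable_input_sqr.
- exact: integrable_noise_sqr.
Qed.

(** Given the noise, the input averages to zero. *)
Lemma integral_input_noise : (\int[P]_w (w.1 * w.2)%:E = 0)%E.
Proof.
rewrite -(integral21_prod_meas1 integrable_input_noise)/=.
rewrite (eq_integral (cst 0)%E) ?integral0//= => n _.
rewrite /fubini_G/=; under eq_integral do rewrite EFinM muleC.
by rewrite integralZl ?mean0 ?mule0//; exact: integrable_id_pi.
Qed.

Lemma measurable_outpdf t : measurable_fun [set: R] (outpdf pi t).
Proof. by apply: measurable_lik_moment; exact: integrable_cst_pi. Qed.

Lemma measurable_postmean t : measurable_fun [set: R] (postmean pi t).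
Proof.
apply: measurable_funM.
  by apply: measurable_lik_moment; exact: integrable_id_pi.
apply: continuous_measurable_fun => y.
apply: cvgV; first by rewrite gt_eqF// outpdf_gt0.
by apply: continuous_lik_momentr; exact: integrable_cst_pi.
Qed.

(** By [sqr_postmean_le], the second moment of the posterior mean is at most
    that of the input. *)
Lemma integral_postmean_sqr_le1 t :
  (\int[P]_w (postmean pi t (t * w.1 + w.2)%R ^+ 2)%:E <= 1)%E.
Proof.
rewrite (ge0_integral_output (phi := fun y => postmean pi t y ^+ 2)); last 2 first.
- by apply: measurable_funX; exact: measurable_postmean.
- by move=> y; exact: sqr_ge0.
rewrite -integral_input_sqr.
rewrite -[leRHS](@eq_integral _ _ _ P setT _
  (fun w => (w.1 ^+ 2 * cst 1 (t * w.1 + w.2))%:E)); last first.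
  by move=> w _; rewrite mulr1.
rewrite (@ge0_integral_input_output (fun x => x ^+ 2) (cst 1))//; last 2 first.
- exact: integrable_sqr_pi.
- by move=> x; exact: sqr_ge0.
apply: ge0_le_integral => //.
- by move=> y _; rewrite lee_fin mulr_ge0 ?sqr_ge0// ltW// outpdf_gt0.
- apply/measurable_EFinP; apply: measurable_funM; last exact: measurable_outpdf.
  by apply: measurable_funX; exact: measurable_postmean.
- apply/measurable_EFinP; apply: measurable_funM => //.
  by apply: measurable_lik_moment; exact: integrable_sqr_pi.
- by move=> y _; rewrite /= mul1r lee_fin sqr_postmean_le.
Qed.

Lemma integrable_postmean_sqr t :
  P.-integrable setT (fun w => (postmean pi t (t * w.1 + w.2) ^+ 2)%:E).
Proof.
apply: integrable_sqr.
  by apply: measurable_output_comp; exact: measurable_postmean.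
by apply: le_lt_trans (integral_postmean_sqr_le1 t) _; rewrite ltry.
Qed.

(** Once the input is averaged given the output, both sides are the integral
    of [phi] times the first unnormalized posterior moment. *)
Lemma postmean_orthogonal (phi : R -> R) t : measurable_fun [set: R] phi ->
  P.-integrable setT (fun w => (w.1 * phi (t * w.1 + w.2))%:E) ->
  P.-integrable setT
    (fun w => (postmean pi t (t * w.1 + w.2) * phi (t * w.1 + w.2))%:E) ->
  (\int[P]_w (w.1 * phi (t * w.1 + w.2)%R)%:E =
   \int[P]_w (postmean pi t (t * w.1 + w.2)%R * phi (t * w.1 + w.2)%R)%:E)%E.
Proof.
move=> mphi ix im.
rewrite (@integral_input_output (fun x => x))//; last exact: integrable_id_pi.
have mm : measurable_fun [set: R] (fun y => postmean pi t y * phi y).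
  by apply: measurable_funM => //; exact: measurable_postmean.
transitivity (\int[P]_w (cst 1 w.1 *
    (postmean pi t (t * w.1 + w.2)%R * phi (t * w.1 + w.2)%R))%:E)%E.
  rewrite (@integral_input_output (cst 1) (fun y => postmean pi t y * phi y));
    last 3 first.
  - exact: integrable_cst_pi.
  - exact: mm.
  - by apply: eq_integrable im => // w _; rewrite /= mul1r.
  by apply: eq_integral => y _; rewrite lik_moment_id// /outpdf; congr EFin; ring.
by apply: eq_integral => w _; rewrite /= mul1r.
Qed.

Lemma integrable_input_postmean t :
  P.-integrable setT (fun w => (w.1 * postmean pi t (t * w.1 + w.2))%:E).
Proof.
apply: integrableM_sqr => //.
- by apply: measurable_output_comp; exact: measurable_postmean.
- exact: integrable_input_sqr.
- exact: integrable_postmean_sqr.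
Qed.

(** The part of the unit variance of the input that the output reveals; the
    rest is the MMSE ([M_funE]). *)
Definition explained (t : R) : R :=
  \int[P]_w (postmean pi t (t * w.1 + w.2) ^+ 2).

Lemma explainedE t :
  ((explained t)%:E = \int[P]_w (postmean pi t (t * w.1 + w.2)%R ^+ 2)%:E)%E.
Proof.
by rewrite fineK//; apply: integrable_fin_num => //; exact: integrable_postmean_sqr.
Qed.

Lemma explained_ge0 t : 0 <= explained t.
Proof. by apply: Rintegral_ge0 => w _; exact: sqr_ge0. Qed.

Lemma explained_le1 t : explained t <= 1.
Proof. by rewrite -lee_fin explainedE integral_postmean_sqr_le1. Qed.

Lemma integral_input_postmean t :
  (\int[P]_w (w.1 * postmean pi t (t * w.1 + w.2)%R)%:E = (explained t)%:E)%E.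
Proof.
rewrite explainedE postmean_orthogonal//.
- exact: measurable_postmean.
- exact: integrable_input_postmean.
- by apply: eq_integrable (integrable_postmean_sqr t) => // w _; rewrite expr2.
Qed.
End channel_expectation.

(** * Conditional expectation and the MMSE *)

Section conditional_expectation.
Context {R : realType} d d' (T : measurableType d) (T' : measurableType d').
Context (P : probability T R) (X : T -> R) (Y : {mfun T >-> T'}).

(** The set [D] on which the inequality fails belongs to the sigma-algebra
    generated by [Y], so both versions have the same integral over [D]; a positive
    function of zero integral over [D] forces [D] to be negligible. *)
Lemma is_cond_expectation_ae_le (Z Z' : T -> R) :
  is_cond_expectation P X Y Z -> is_cond_expectation P X Y Z' ->
  \forall w \ae P, Z w <= Z' w.
Proof.
move=> [mZ iZ EZ] [mZ' iZ' EZ'].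
pose D : set T := (fun w => Z w - Z' w) @^-1` `]0, +oo[.
have [B mB DB] : exists2 B : set T', measurable B & Y @^-1` B = D.
  have := measurable_funB mZ mZ'.
  move=> /(_ measurableT _ (measurable_itv `]0, +oo[))[B mB].
  by rewrite setTI setTI => BE; exists B.
have mD : measurable D.
  rewrite -DB -[X in measurable X]setTI.
  exact: (measurable_funP Y measurableT).
have iDZ := integrableS measurableT mD (@subsetT _ _) iZ.
have iDZ' := integrableS measurableT mD (@subsetT _ _) iZ'.
have E0 : (\int[P]_(w in D) (Z w - Z' w)%:E = 0)%E.
  under eq_integral do rewrite EFinB.
  rewrite integralB//= -DB.
  rewrite EZ// EZ'// -EZ// subee//.
  by rewrite DB; exact: integrable_fin_num iDZ.
have mZZ : measurable_fun D (EFin \o (fun w => Z w - Z' w)).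
  have := measurable_int _ (integrableB mD iDZ iDZ').
  by apply: eq_measurable_fun.
have /(ae_eq_integral_abs _ mD mZZ) : (\int[P]_(w in D) `|(Z w - Z' w)%:E| = 0)%E.
  rewrite -E0; apply: eq_integral => w /set_mem.
  by rewrite /D/= in_itv/= andbT => /ltW ?; rewrite ger0_norm.
apply: filterS => w /= H; rewrite leNgt; apply/negP => lt.
have Dw : D w by rewrite /D/= in_itv/= andbT subr_gt0.
by have [/eqP] := H Dw; rewrite subr_eq0 (gt_eqF lt).
Qed.

Lemma is_cond_expectation_ae_eq (Z Z' : T -> R) :
  is_cond_expectation P X Y Z -> is_cond_expectation P X Y Z' ->
  \forall w \ae P, Z w = Z' w.
Proof.
move=> cZ cZ'.
have := is_cond_expectation_ae_le cZ cZ'.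
have := is_cond_expectation_ae_le cZ' cZ.
by apply: filterS2 => w h1 h2; apply/eqP; rewrite eq_le h1 h2.
Qed.

Lemma mmseE (Z : T -> R) : measurable_fun setT X ->
  is_cond_expectation P X Y Z -> mmse P X Y = (\int[P]_w ((X w - Z w) ^+ 2)%:E)%E.
Proof.
move=> mX cZ.
have cE : is_cond_expectation P X Y (cond_expectation P X Y).
  by rewrite /cond_expectation; case: xgetP => [_ ->//|/(_ Z)].
have mZ : measurable_fun setT Z.
  by case: cZ => _ iZ _; apply/measurable_EFinP; exact: measurable_int iZ.
have mE : measurable_fun setT (cond_expectation P X Y).
  by case: cE => _ iZ _; apply/measurable_EFinP; exact: measurable_int iZ.
rewrite /mmse unlock; apply: ae_eq_integral => //.
- by apply/measurable_EFinP; apply: measurable_funX; exact: measurable_funB.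
- by apply/measurable_EFinP; apply: measurable_funX; exact: measurable_funB.
- have := is_cond_expectation_ae_eq cE cZ.
  by apply: filterS => w /= -> _.
Qed.
End conditional_expectation.

Section scalar_mmse.
Context {R : realType}.
Local Notation RR := (measurableTypeR R * measurableTypeR R)%type.
Context (pi : probability (measurableTypeR R) R).
Local Notation P := (channel_prob pi).
Hypothesis mean0 : (\int[pi]_x x%:E = 0)%E.
Hypothesis sqr1 : (\int[pi]_x (x ^+ 2)%:E = 1)%E.

Lemma integrable_input : P.-integrable setT (fun w => (w.1)%:E).
Proof. by apply: integrable_of_sqr; last exact: integrable_input_sqr. Qed.

Lemma integrable_postmean t :
  P.-integrable setT (fun w => (postmean pi t (t * w.1 + w.2))%:E).
Proof.
apply: integrable_of_sqr; last exact: integrable_postmean_sqr.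
by apply: measurable_output_comp; exact: measurable_postmean.
Qed.

Lemma integral_preimage_output (Z : RR -> R) t (B : set R) : measurable B ->
  (\int[P]_(w in (fun w : RR => (t * w.1 + w.2)%R) @^-1` B) (Z w)%:E =
   \int[P]_w (Z w * \1_B (t * w.1 + w.2)%R)%:E)%E.
Proof.
move=> mB; rewrite integral_mkcond; apply: eq_integral => w _.
rewrite patchE /= indicE; case: ifPn => [/set_mem/= h|/negP h].
  by rewrite mem_set// mulr1.
rewrite memNset ?mulr0// => h'; apply: h; exact/mem_set.
Qed.

Lemma integrable_mul_indic (Z : RR -> R) t (B : set R) : measurable B ->
  P.-integrable setT (fun w => (Z w)%:E) ->
  P.-integrable setT (fun w => (Z w * \1_B (t * w.1 + w.2))%:E).
Proof.
move=> mB iZ.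
have mZ : measurable_fun setT Z by apply/measurable_EFinP; exact: measurable_int iZ.
have mI : measurable_fun [set: R] (\1_B : R -> R) by exact: measurable_indic.
apply: (@integrable_dominated _ _ _ P _ (fun w : RR => `|Z w|)).
- by apply: measurable_funM => //; exact: (measurable_output_comp t mI).
- exact: integrable_norm.
- move=> w; rewrite normrM ler_piMr// indicE.
  by case: (_ \in _); rewrite ?normr1 ?normr0.
Qed.

Lemma postmean_is_cond_expectation s :
  is_cond_expectation P channel_input (channel_output s)
    (fun w => postmean pi (Num.sqrt s) (channel_output s w)).
Proof.
split.
- move=> _ A mA; rewrite setTI.
  exists (postmean pi (Num.sqrt s) @^-1` A); last by rewrite setTI.
  by rewrite -[X in measurable X]setTI; exact: (measurable_postmean mean0 sqr1).
- exact: integrable_postmean.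
- move=> B mB.
  rewrite (integral_preimage_output
    (fun w => postmean pi (Num.sqrt s) (channel_output s w)) _ mB).
  rewrite (integral_preimage_output (fun w => w.1) _ mB).
  apply/esym/postmean_orthogonal => //.
  + exact: integrable_mul_indic integrable_input.
  + exact: integrable_mul_indic (integrable_postmean _).
Qed.

(** Expanding the square, the cross term equals the second moment of the
    posterior mean by orthogonality. *)
Lemma M_funE s : M_fun pi s = 1 - explained pi (Num.sqrt s).
Proof.
rewrite /M_fun (mmseE _ (postmean_is_cond_expectation s)); last exact: measurable_fst.
set t := Num.sqrt s.
have i1 := integrable_input_sqr sqr1.
have i2 := integrable_input_postmean mean0 sqr1 t.
have i3 := integrable_postmean_sqr mean0 sqr1 t.
transitivity (\int[P]_w (w.1 ^+ 2 + (- 2) * (w.1 * postmean pi t (t * w.1 + w.2)) +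
    postmean pi t (t * w.1 + w.2) ^+ 2)).
  congr fine; apply: eq_integral => w _; congr EFin.
  rewrite /channel_input /channel_output -/t; ring.
rewrite RintegralD//; last by apply: integrable_add => //; exact: integrable_scale.
rewrite RintegralD//; last exact: integrable_scale.
rewrite RintegralZl// -/(explained pi t) /Rintegral.
rewrite integral_input_sqr// integral_input_postmean//=; ring.
Qed.
End scalar_mmse.

(** * Kullback-Leibler divergence and mutual information *)

Section kl_density.
Context {R : realType} d (T : measurableType d) (P Q : probability T R).

(** The Radon-Nikodym derivative is determined almost everywhere for [Q], hence
    also for [P], and any density of [P] can replace it under the logarithm. *)
Lemma kl_divergence_density (k : T -> R) : measurable_fun setT k ->
  (forall z, 0 < k z) ->
  (forall A, measurable A -> P A = \int[Q]_(z in A) (k z)%:E)%E ->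
  kl_divergence P Q = (\int[P]_z (ln (k z))%:E)%E.
Proof.
move=> mk k0 PE.
have dom : P `<< Q.
  apply/null_content_dominatesP => A mA QA0; rewrite PE//.
  apply: null_set_integral => //.
  by apply: measurable_funTS; exact/measurable_EFinP.
rewrite /kl_divergence asboolT//.
set nu := charge_of_finite_measure P; set f := Radon_Nikodym nu Q.
have domnu : nu `<< Q by exact: dom.
have ifn : Q.-integrable setT f by exact: Radon_Nikodym_integrable.
have mf : measurable_fun setT f := measurable_int _ ifn.
have fk : ae_eq Q setT f (EFin \o k).
  apply: integral_ae_eq => //; first exact/measurable_EFinP.
  by move=> E _ mE; rewrite -Radon_Nikodym_integral//= -PE.
have ffin z : f z \is a fin_num by exact: Radon_Nikodym_fin_num.
apply: ae_eq_integral => //.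
- rewrite (_ : (fun z => lne (f z)) =
      fun z => if fine (f z) <= 0 then -oo%E else (ln (fine (f z)))%:E); last first.
    by apply/funext => z; rewrite -[in lne _](fineK (ffin z)).
  have mff : measurable_fun setT (fine \o f) by exact: measurableT_comp.
  apply: measurable_fun_ifT.
  + by apply: measurable_fun_ler.
  + exact: measurable_cst.
  + by apply/measurable_EFinP; apply: (measurableT_comp (@measurable_ln R)).
- by apply/measurable_EFinP; apply: (measurableT_comp (@measurable_ln R)).
- have := null_dominates_ae_eq measurableT dom fk.
  by apply: filterS => z /= H _; rewrite H// lne_EFin.
Qed.
End kl_density.

Section scalar_mutual_information.
Context {R : realType}.
Local Notation mu := (@lebesgue_measure R).
Local Notation RR := (measurableTypeR R * measurableTypeR R)%type.
Context (pi : probability (measurableTypeR R) R).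
Local Notation P := (channel_prob pi).
Hypothesis mean0 : (\int[pi]_x x%:E = 0)%E.
Hypothesis sqr1 : (\int[pi]_x (x ^+ 2)%:E = 1)%E.

Lemma integrable_output_sqr t :
  P.-integrable setT (fun w => ((t * w.1 + w.2) ^+ 2)%:E).
Proof.
apply: (@integrable_dominated _ _ _ P _
  (fun w : RR => 2 * t ^+ 2 * w.1 ^+ 2 + 2 * w.2 ^+ 2)).
- by apply: measurable_funX; exact: measurable_output.
- apply: integrable_add; apply: integrable_scale.
    exact: integrable_input_sqr.
  exact: integrable_noise_sqr.
- move=> w; rewrite ger0_norm ?sqr_ge0//.
  have := sqr_ge0 (t * w.1 - w.2); rewrite sqrrB sqrrD -mulr_natl exprMn; lra.
Qed.

(** The output density lies between a constant and a Gaussian, so that its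
    logarithm grows at most quadratically. *)
Lemma ln_outpdf_norm t y : `|ln (outpdf pi t y)| <=
  `|ln (normal_peak 1)| + t ^+ 2 / 2 + 2^-1 * y ^+ 2.
Proof.
have p0 : 0 < normal_peak 1 :> R by rewrite normal_peak_gt0 ?oner_eq0.
have := outpdf_ge mean0 sqr1 t y; have := outpdf_le pi t y.
have f0 := outpdf_gt0 mean0 sqr1 t y.
rewrite -ler_ln ?posrE// => l1.
rewrite -ler_ln ?posrE// ?mulr_gt0 ?expR_gt0// lnM ?posrE ?expR_gt0// expRK => l2.
have := ler_norm (ln (normal_peak 1 : R)); have := ler_norm (- ln (normal_peak 1 : R)).
rewrite normrN => l3 l4.
have y2 := sqr_ge0 y; have t2 := sqr_ge0 t.
rewrite ler_norml; apply/andP; split; lra.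
Qed.

Lemma measurable_ln_outpdf t : measurable_fun [set: R] (fun y => ln (outpdf pi t y)).
Proof. exact: (measurableT_comp (@measurable_ln R) (measurable_outpdf pi t)). Qed.

Lemma integrable_ln_outpdf_gen t t' :
  P.-integrable setT (fun w => (ln (outpdf pi t (t' * w.1 + w.2)))%:E).
Proof.
apply: (@integrable_dominated _ _ _ P _ (fun w : RR =>
  (`|ln (normal_peak 1)| + t ^+ 2 / 2) + 2^-1 * (t' * w.1 + w.2) ^+ 2)).
- exact: (measurable_output_comp t' (measurable_ln_outpdf t)).
- apply: integrable_add; first exact: finite_measure_integrable_cst.
  by apply: integrable_scale; exact: integrable_output_sqr.
- by move=> w; exact: ln_outpdf_norm.
Qed.

Lemma integrable_ln_gpdf : P.-integrable setT (fun w => (ln (gpdf w.2))%:E).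
Proof.
have lng (x : R) : ln (gpdf x) = ln (normal_peak 1) + (- 2^-1) * x ^+ 2.
  by rewrite gpdfE lnM ?posrE ?expR_gt0 ?normal_peak_gt0 ?oner_eq0// expRK; lra.
under eq_fun do rewrite lng.
apply: integrable_add; first exact: finite_measure_integrable_cst.
by apply: integrable_scale; exact: integrable_noise_sqr.
Qed.

(** The density of the joint law of input and output with respect to the
    product of their laws. *)
Definition likelihood_ratio (t : R) (z : RR) : R := lik t z.1 z.2 / outpdf pi t z.2.

Lemma likelihood_ratio_gt0 t z : 0 < likelihood_ratio t z.
Proof. by rewrite divr_gt0 ?lik_gt0 ?(outpdf_gt0 mean0 sqr1). Qed.

Lemma measurable_likelihood_ratio t : measurable_fun [set: RR] (likelihood_ratio t).
Proof.
apply: measurable_funM; first by apply/measurable_EFinP; exact: measurable_lik.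
have mV : measurable_fun [set: R] (fun y => (outpdf pi t y)^-1).
  apply: continuous_measurable_fun => y.
  apply: cvgV; first by rewrite gt_eqF// (outpdf_gt0 mean0 sqr1).
  by apply: continuous_lik_momentr; exact: integrable_cst_pi.
by apply: (measurableT_comp mV).
Qed.

Lemma ge0_integral_marginals s (F : RR -> \bar R) : measurable_fun [set: RR] F ->
  (forall z, 0 <= F z)%E ->
  (\int[distribution P channel_input \x distribution P (channel_output s)]_z F z =
   \int[pi \x mu]_z (F z * (outpdf pi (Num.sqrt s) z.2)%:E))%E.
Proof.
move=> mF F0.
have mFo : measurable_fun [set: RR]
    (fun z : RR => (F z * (outpdf pi (Num.sqrt s) z.2)%:E)%E).
  apply: emeasurable_funM => //; apply/measurable_EFinP.
  by apply: (measurableT_comp (measurable_outpdf pi (Num.sqrt s))).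
have Fo0 (z : RR) : (0 <= F z * (outpdf pi (Num.sqrt s) z.2)%:E)%E.
  by rewrite mule_ge0// lee_fin ltW// outpdf_gt0.
rewrite (fubini_tonelli1 _ mF F0) (fubini_tonelli1 _ mFo Fo0).
have mG := @measurable_fun_fubini_tonelli_F _ _ _ _ _
  (distribution P (channel_output s)) _ mF F0.
rewrite ge0_integral_distribution; last 2 first.
- exact: mG.
- by move=> x; apply: integral_ge0.
transitivity (\int[pi]_x fubini_F (distribution P (channel_output s)) F x)%E.
  apply: (ge0_integral_input pi mG) => x.
  exact: integral_ge0.
apply: eq_integral => x _; rewrite /fubini_F/=.
have mFx : measurable_fun [set: R] (fun y => F (x, y)).
  exact: (measurableT_comp mF (pair1_measurable x)).
rewrite ge0_integral_distribution//.
by rewrite -(@ge0_integral_output_ereal _ pi (fun y => F (x, y))).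
Qed.

Lemma joint_density s (A : set RR) : measurable A ->
  distribution P (pair_rv channel_input (channel_output s)) A =
  (\int[distribution P channel_input \x distribution P (channel_output s)]_(z in A)
     (likelihood_ratio (Num.sqrt s) z)%:E)%E.
Proof.
move=> mA; set t := Num.sqrt s.
have mI : measurable_fun [set: RR] (fun z => (\1_A z : R)%:E).
  by apply/measurable_EFinP; exact: measurable_indic.
transitivity (\int[distribution P (pair_rv channel_input (channel_output s))]_z
    (\1_A z : R)%:E)%E.
  by rewrite integral_indic; [rewrite setIT|exact: measurableT|exact: mA].
rewrite ge0_integral_distribution; last 2 first.
- exact: mI.
- by move=> z; rewrite lee_fin.
transitivity (\int[P]_w (\1_A (transmit t w) : R)%:E)%E; first by [].
rewrite (ge0_integral_channel pi t mI); last by move=> z; rewrite lee_fin.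
rewrite [RHS]integral_mkcond.
rewrite [RHS](eq_integral (fun z => (\1_A z)%:E * (likelihood_ratio t z)%:E)%E); last first.
  move=> z _; rewrite patchE indicE; case: ifPn => _; by rewrite ?mul1e ?mul0e.
rewrite ge0_integral_marginals; last 2 first.
- apply: emeasurable_funM => //; apply/measurable_EFinP; exact: measurable_likelihood_ratio.
- by move=> z; rewrite -EFinM lee_fin mulr_ge0// ltW// likelihood_ratio_gt0.
apply: eq_integral => z _; rewrite -!EFinM; congr EFin.
by rewrite /likelihood_ratio -mulrA divfK// gt_eqF// (outpdf_gt0 mean0 sqr1).
Qed.

Lemma I_funE s : I_fun pi s =
  \int[P]_w (ln (gpdf w.2) - ln (outpdf pi (Num.sqrt s) (Num.sqrt s * w.1 + w.2))).
Proof.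
set t := Num.sqrt s.
have mL : measurable_fun [set: RR] (fun z => (ln (likelihood_ratio t z))%:E).
  apply/measurable_EFinP; apply: (measurableT_comp (@measurable_ln R)).
  exact: measurable_likelihood_ratio.
(* at the true input, the likelihood is the density of the noise *)
have lE w : ln (likelihood_ratio t (transmit t w)) =
    ln (gpdf w.2) - ln (outpdf pi t (t * w.1 + w.2)).
  rewrite ln_div ?posrE ?lik_gt0 ?(outpdf_gt0 mean0 sqr1)//=.
  by congr (ln _ - _); rewrite /lik; congr gpdf; rewrite addrAC subrr add0r.
rewrite /I_fun /mutual_information.
rewrite (@kl_divergence_density _ _ _ _ _ (likelihood_ratio t)); last 3 first.
- exact: measurable_likelihood_ratio.
- exact: likelihood_ratio_gt0.
- exact: joint_density.
rewrite integral_distribution//.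
  by congr fine; apply: eq_integral => w _; rewrite /= -lE.
apply: (@eq_integrable _ _ _ P setT measurableT
  (fun w => (ln (gpdf w.2) - ln (outpdf pi t (t * w.1 + w.2)))%:E)).
  by move=> w _; rewrite /= -lE.
apply: integrable_sub; first exact: integrable_ln_gpdf.
exact: integrable_ln_outpdf_gen.
Qed.
End scalar_mutual_information.

(** * The tangent inequality for the mutual information *)

Lemma ln_le_subr1 (R : realType) (x : R) : 0 < x -> ln x <= x - 1.
Proof.
move=> x0; have := expR_ge1Dx (ln x); rewrite lnK ?posrE//.
by rewrite addrC lerBrDr.
Qed.

Lemma combine_le (R : realDomainType) (a b c r e : R) :
  a + e <= b -> b - c <= r - 1 -> 1 - r + e <= c - a.
Proof. by move=> *; lra. Qed.

Lemma shift_le (R : realDomainType) (a b c d e : R) :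
  - d + e <= c - b -> a - c <= a - b + d - e.
Proof. by move=> *; lra. Qed.

Lemma tangent_le (R : realFieldType) (i i' t t' e : R) : e <= 1 ->
  i' <= i + (t' ^+ 2 - t ^+ 2) / 2 - t * (t' - t) * e ->
  i' - i <= (t' ^+ 2 - t ^+ 2) / 2 * (1 - e) + (t' - t) ^+ 2 / 2.
Proof.
move=> e1 h; have : (t' - t) ^+ 2 / 2 * e <= (t' - t) ^+ 2 / 2.
  by rewrite ler_piMr// divr_ge0// sqr_ge0.
lra.
Qed.

Section tangent_inequality.
Context {R : realType}.
Local Notation mu := (@lebesgue_measure R).
Local Notation RR := (measurableTypeR R * measurableTypeR R)%type.
Context (pi : probability (measurableTypeR R) R).
Local Notation P := (channel_prob pi).
Hypothesis mean0 : (\int[pi]_x x%:E = 0)%E.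
Hypothesis sqr1 : (\int[pi]_x (x ^+ 2)%:E = 1)%E.

(** The mutual information as a function of the amplitude [t]: the
    entropy of the output minus that of the noise ([I_funE]). *)
Definition info (t : R) : R :=
  \int[P]_w (ln (gpdf w.2) - ln (outpdf pi t (t * w.1 + w.2))).

Lemma integral_outpdf t : (\int[mu]_y (outpdf pi t y)%:E = 1)%E.
Proof.
transitivity (\int[P]_w (cst 1 (t * w.1 + w.2)%R : R)%:E)%E.
  rewrite (@ge0_integral_output _ _ (cst 1))//.
  by apply: eq_integral => y _; rewrite /= mul1r.
rewrite -[LHS]/(integral P setT (cst 1%E)) integral_cst; last exact: measurableT.
by rewrite [X in (_ * X)%E](@probability_setT _ _ _ P) mule1.
Qed.

(** The Gibbs inequality compares two output densities through their
    ratio. *)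
Let ratio t t' y := outpdf pi t y / outpdf pi t' y.

Lemma ratio_ge0 t t' y : 0 <= ratio t t' y.
Proof. by rewrite divr_ge0// ltW// outpdf_gt0. Qed.

Lemma measurable_ratio t t' : measurable_fun [set: R] (ratio t t').
Proof.
apply: measurable_funM; first exact: measurable_outpdf.
apply: continuous_measurable_fun => y.
apply: cvgV; first by rewrite gt_eqF// (outpdf_gt0 mean0 sqr1).
by apply: continuous_lik_momentr; exact: integrable_cst_pi.
Qed.

Lemma integral_ratio t t' : (\int[P]_w (ratio t t' (t' * w.1 + w.2)%R)%:E = 1)%E.
Proof.
rewrite (@ge0_integral_output _ _ (ratio t t')).
- rewrite -(integral_outpdf t); apply: eq_integral => y _.
  by rewrite /ratio divfK// gt_eqF// (outpdf_gt0 mean0 sqr1).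
- exact: measurable_ratio.
- exact: ratio_ge0.
Qed.

Lemma integrable_ratio t t' :
  P.-integrable setT (fun w => (ratio t t' (t' * w.1 + w.2))%:E).
Proof.
apply/integrableP; split.
  by apply/measurable_EFinP; exact: (measurable_output_comp t' (measurable_ratio t t')).
under eq_integral do rewrite /= ger0_norm ?ratio_ge0//.
by rewrite integral_ratio ltry.
Qed.

(** An integrable lower bound for the change of the log output density along
    the coupling by a common noise. Its first part is the Gibbs inequality, the
    rest is the tangent of [outpdf_tangent] written in terms of input and noise. *)
Let bound t t' (x n : R) : R :=
  1 - ratio t t' (t' * x + n) + (- ((t' ^+ 2 - t ^+ 2) / 2) * x ^+ 2 +
   (- (t' - t) * (x * n) +
    t * (t' - t) * (x * postmean pi t (t * x + n)))).

Lemma le_bound t t' (x n : R) : bound t t' x n <=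
  ln (outpdf pi t' (t' * x + n)) - ln (outpdf pi t (t * x + n)).
Proof.
set y := t * x + n; set y' := t' * x + n.
have f0 s z : 0 < outpdf pi s z by exact: outpdf_gt0.
have := outpdf_tangent mean0 sqr1 t y y'.
rewrite -ler_ln ?posrE ?mulr_gt0 ?expR_gt0//.
rewrite lnM ?posrE ?expR_gt0// expRK => h1.
have r0 : 0 < ratio t t' y' by rewrite divr_gt0.
have := ln_le_subr1 r0.
rewrite ln_div ?posrE// => h2.
have -> : bound t t' x n = 1 - ratio t t' y' +
    (- ((y' ^+ 2 - y ^+ 2) / 2) + t * postmean pi t y * (y' - y)).
  by rewrite /bound -/y -/y'; congr (_ + _); rewrite /y /y'; field.
exact: combine_le h1 h2.
Qed.

(** Averaging [bound]: the ratio of densities has mean 1, so the Gibbs part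
    disappears; the input-noise term has mean 0, and the posterior mean correlates
    with the input exactly as much as with itself. *)
Lemma info_tangent t t' :
  info t' <= info t + (t' ^+ 2 - t ^+ 2) / 2 - t * (t' - t) * explained pi t.
Proof.
have i0 : P.-integrable setT (fun w => (cst 1 w : R)%:E).
  exact: finite_measure_integrable_cst.
have i1 := integrable_ratio t t'.
have i2 := integrable_input_sqr sqr1.
have i3 := integrable_input_noise sqr1.
have i4 := integrable_input_postmean mean0 sqr1 t.
have j1 := integrable_ln_outpdf_gen mean0 sqr1 t t.
have j2 := integrable_ln_outpdf_gen mean0 sqr1 t' t'.
have j3 := integrable_ln_gpdf pi.
have k1 := integrable_sub i0 i1.
have k2 := integrable_scale (- ((t' ^+ 2 - t ^+ 2) / 2)) i2.
have k3 := integrable_scale (- (t' - t)) i3.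
have k4 := integrable_scale (t * (t' - t)) i4.
have k34 := integrable_add k3 k4.
have k234 := integrable_add k2 k34.
have ib : P.-integrable setT (fun w => (bound t t' w.1 w.2)%:E).
  exact: integrable_add k1 k234.
have : \int[P]_w bound t t' w.1 w.2 <=
    \int[P]_w (ln (outpdf pi t' (t' * w.1 + w.2)) - ln (outpdf pi t (t * w.1 + w.2))).
  apply: (le_Rintegral measurableT ib (integrable_sub j2 j1)) => w _.
  exact: le_bound.
rewrite (RintegralB measurableT j2 j1).
have -> : \int[P]_w bound t t' w.1 w.2 =
   - ((t' ^+ 2 - t ^+ 2) / 2) + t * (t' - t) * explained pi t.
  rewrite /bound (RintegralD measurableT k1 k234) (RintegralD measurableT k2 k34).
  rewrite (RintegralD measurableT k3 k4) (RintegralB measurableT i0 i1).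
  rewrite (RintegralZl _ measurableT i2) (RintegralZl _ measurableT i3).
  rewrite (RintegralZl _ measurableT i4).
  rewrite (Rintegral_cst _ measurableT) [X in fine X](@probability_setT _ _ _ P).
  rewrite {1}/Rintegral integral_ratio {1}/Rintegral (integral_input_sqr sqr1).
  rewrite {1}/Rintegral (integral_input_noise mean0 sqr1).
  rewrite {1}/Rintegral (integral_input_postmean mean0 sqr1)/=.
  ring.
have infoE s : info s = \int[P]_w ln (gpdf w.2) -
    \int[P]_w ln (outpdf pi s (s * w.1 + w.2)).
  exact: (RintegralB measurableT j3 (integrable_ln_outpdf_gen mean0 sqr1 s s)).
rewrite !infoE.
exact: shift_le.
Qed.

Lemma info_mmse_upper t t' : info t' - info t <=
  (t' ^+ 2 - t ^+ 2) / 2 * (1 - explained pi t) + (t' - t) ^+ 2 / 2.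
Proof.
exact: tangent_le (explained_le1 mean0 sqr1 t) (info_tangent t t').
Qed.
End tangent_inequality.

(** * Monotonicity in the signal-to-noise ratio *)

Lemma double_le (R : realDomainType) (x y : R) : 2 * x - x <= y -> x <= y.
Proof. by move=> ?; lra. Qed.

Lemma polarization_le (R : realDomainType) (x y : R) :
  2 * (x * y) - y ^+ 2 <= x ^+ 2.
Proof. have := sqr_ge0 (x - y); rewrite sqrrB -mulr_natl; lra. Qed.

Section monotonicity.
Context {R : realType}.
Local Notation mu := (@lebesgue_measure R).
Local Notation gauss := (normal_prob (0:R) 1 : probability (measurableTypeR R) R).
Local Notation RR := (measurableTypeR R * measurableTypeR R)%type.
Local Notation RRR := (RR * measurableTypeR R)%type.
Context (pi : probability (measurableTypeR R) R).
Local Notation P := (channel_prob pi).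
Hypothesis mean0 : (\int[pi]_x x%:E = 0)%E.
Hypothesis sqr1 : (\int[pi]_x (x ^+ 2)%:E = 1)%E.

(** A second independent noise is mixed in so that the total noise keeps
    variance 1 when [c ^+ 2 + sigma ^+ 2 = 1]. *)
Definition mixnoise (c sigma : R) (z : RRR) : RR :=
  (z.1.1, c * z.1.2 + sigma * z.2).

Lemma measurable_mixnoise c sigma : measurable_fun [set: RRR] (mixnoise c sigma).
Proof.
apply: measurable_fun_pair.
  by apply: (measurableT_comp measurable_fst); exact: measurable_fst.
apply: measurable_funD; apply: measurable_funM => //.
by apply: (measurableT_comp measurable_snd); exact: measurable_fst.
Qed.

Lemma ge0_integral_mixnoise c sigma (F : RR -> \bar R) :
  0 < sigma -> c ^+ 2 + sigma ^+ 2 = 1 ->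
  measurable_fun [set: RR] F -> (forall w, 0 <= F w)%E ->
  (\int[P \x gauss]_z F (mixnoise c sigma z) = \int[P]_w F w)%E.
Proof.
move=> s0 cs mF F0.
have mG := measurableT_comp mF (measurable_mixnoise c sigma).
have G0 z : (0 <= (F \o mixnoise c sigma) z)%E by exact: F0.
rewrite (@fubini_tonelli1 _ _ _ _ _ P gauss _ mG G0).
have mH := @measurable_fun_fubini_tonelli_F _ _ _ _ _ gauss _ mG G0.
have H0 w : (0 <= fubini_F gauss (F \o mixnoise c sigma) w)%E.
  exact: integral_ge0.
rewrite (@fubini_tonelli1 _ _ _ _ _ pi gauss _ mH H0).
rewrite (@fubini_tonelli1 _ _ _ _ _ pi gauss _ mF F0).
apply: eq_integral => x _.
apply: (@gauss_stable _ (fun u => F (x, u)) c sigma s0 cs).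
  exact: (measurableT_comp mF (pair1_measurable x)).
by move=> u; exact: F0.
Qed.

Lemma ge0_integral_fst3 (F : RR -> \bar R) :
  measurable_fun [set: RR] F -> (forall w, 0 <= F w)%E ->
  (\int[P \x gauss]_z F z.1 = \int[P]_w F w)%E.
Proof.
move=> mF F0.
rewrite (@fubini_tonelli1 _ _ _ _ _ P gauss (fun z : RRR => F z.1)).
- apply: eq_integral => w _; rewrite /fubini_F/= integral_cst; last exact: measurableT.
  by rewrite [X in (_ * X)%E](@probability_setT _ _ _ gauss) mule1.
- exact: (measurableT_comp mF measurable_fst).
- by move=> z; exact: F0.
Qed.

Lemma integral_mixnoise c sigma (F : RR -> R) :
  0 < sigma -> c ^+ 2 + sigma ^+ 2 = 1 -> measurable_fun [set: RR] F ->
  (P \x gauss)%E.-integrable setT (fun z => (F (mixnoise c sigma z))%:E) ->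
  (\int[P \x gauss]_z (F (mixnoise c sigma z))%:E = \int[P]_w (F w)%:E)%E.
Proof.
move=> s0 cs mF iF.
have [|||_ ->] := @integral_transfer R _ _ RRR RR (P \x gauss)%E P
  (mixnoise c sigma) (cst 1) _ _ _ _ mF iF.
- exact: measurable_cst.
- by move=> ?.
- move=> G mG G0; rewrite (ge0_integral_mixnoise s0 cs mG G0).
  by apply: eq_integral => w _; rewrite mule1.
by apply: eq_integral => w _; rewrite mulr1.
Qed.

(** With [c = a / b], the output of amplitude [a] is distributed as [c] times
    the output of amplitude [b] plus [sigma] times a fresh noise. Let [v] be the
    posterior mean of amplitude [a] at this simulated output and [G] the one of
    amplitude [b]. For each value of the fresh noise [v] is a function of the
    output of amplitude [b], so [G] and the input have the same correlation with
    [v], namely [explained pi a]. Then [2 * (G * v) - v ^+ 2 <= G ^+ 2] averages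
    to the claim. *)
Lemma explained_lt a b : 0 <= a -> a < b -> explained pi a <= explained pi b.
Proof.
move=> a0 ab; have b0 : 0 < b by exact: le_lt_trans ab.
pose c := a / b; pose sigma := Num.sqrt (1 - c ^+ 2).
have c1 : c ^+ 2 < 1.
  rewrite expr_lt1//; last by rewrite divr_ge0// ltW.
  by rewrite /c ltr_pdivrMr// mul1r.
have s0 : 0 < sigma by rewrite sqrtr_gt0 subr_gt0.
have cs : c ^+ 2 + sigma ^+ 2 = 1.
  by rewrite sqr_sqrtr ?subr_ge0 1?ltW// addrC subrK.
pose F (w : RR) := postmean pi a (a * w.1 + w.2).
have mF : measurable_fun setT F :=
  measurable_output_comp a (measurable_postmean mean0 sqr1 a).
pose v z := F (mixnoise c sigma z).
have mv : measurable_fun setT v := measurableT_comp mF (measurable_mixnoise c sigma).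
pose G (w : RR) := postmean pi b (b * w.1 + w.2).
have mG : measurable_fun setT G :=
  measurable_output_comp b (measurable_postmean mean0 sqr1 b).
have mG1 : measurable_fun setT (fun z : RRR => G z.1) :=
  measurableT_comp mG measurable_fst.
have mx : measurable_fun setT (fun z : RRR => z.1.1).
  exact: (measurableT_comp measurable_fst measurable_fst).
have sqE (f : RR -> R) : measurable_fun setT f ->
    measurable_fun setT (fun w => (f w ^+ 2)%:E).
  by move=> mf; apply/measurable_EFinP; exact: measurable_funX.
have sq0 (f : RR -> R) w : (0 <= (f w ^+ 2)%:E)%E by rewrite lee_fin sqr_ge0.
have Ev : (\int[P \x gauss]_z (v z ^+ 2)%:E = (explained pi a)%:E)%E.
  by rewrite (ge0_integral_mixnoise s0 cs (sqE _ mF) (sq0 F)) (explainedE mean0 sqr1).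
have EG : (\int[P \x gauss]_z (G z.1 ^+ 2)%:E = (explained pi b)%:E)%E.
  by rewrite (ge0_integral_fst3 (sqE _ mG) (sq0 G)) (explainedE mean0 sqr1).
have Ex : (\int[P \x gauss]_z (z.1.1 ^+ 2)%:E = 1)%E.
  rewrite (ge0_integral_fst3 (sqE _ measurable_fst) (sq0 fst)).
  exact: (integral_input_sqr sqr1).
have iv : (P \x gauss)%E.-integrable setT (fun z => (v z ^+ 2)%:E).
  by apply: (integrable_sqr mv); rewrite Ev ltry.
have iG : (P \x gauss)%E.-integrable setT (fun z => (G z.1 ^+ 2)%:E).
  by apply: (integrable_sqr mG1); rewrite EG ltry.
have ix : (P \x gauss)%E.-integrable setT (fun z => (z.1.1 ^+ 2)%:E).
  by apply: (integrable_sqr mx); rewrite Ex ltry.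
have ixv := integrableM_sqr mx mv ix iv.
have iGv := integrableM_sqr mG1 mv iG iv.
have Exv : (\int[P \x gauss]_z (z.1.1 * v z)%:E = (explained pi a)%:E)%E.
  rewrite -(integral_input_postmean mean0 sqr1).
  have mxF : measurable_fun [set: RR] (fun w : RR => w.1 * F w).
    exact: (measurable_funM measurable_fst mF).
  exact: (integral_mixnoise s0 cs mxF ixv).
have EGv : (\int[P \x gauss]_z (G z.1 * v z)%:E = (explained pi a)%:E)%E.
  rewrite -Exv -(integral21_prod_meas1 iGv) -(integral21_prod_meas1 ixv).
  apply: ae_eq_integral; first exact: measurableT.
  - exact: (measurable_fubini_G iGv).
  - exact: (measurable_fubini_G ixv).
  (* orthogonality holds for almost every value of the fresh noise, those for
     which both products are integrable *)
  have := ae_integrable2 iGv; have := ae_integrable2 ixv.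
  apply: filterS2 => n i1 i2 _; rewrite /fubini_G/=.
  pose phi y := postmean pi a (c * y + sigma * n).
  have vE (w : RR) : v (w, n) = phi (b * w.1 + w.2).
    rewrite /v /F /phi/=; congr (postmean pi a _).
    by rewrite mulrDr mulrA divfK ?gt_eqF// addrA.
  have mphi : measurable_fun setT phi.
    apply: (measurableT_comp (measurable_postmean mean0 sqr1 a)).
    exact: measurable_affine.
  apply/esym.
  under eq_integral do rewrite vE.
  under [RHS]eq_integral do rewrite vE.
  apply: (postmean_orthogonal mean0 sqr1 mphi).
  - apply: (@eq_integrable _ _ _ P setT measurableT _ _ _ i1) => w _.
    by rewrite /= vE.
  - apply: (@eq_integrable _ _ _ P setT measurableT _ _ _ i2) => w _.
    by rewrite /= vE.
apply: double_le.
have i2 := integrable_scale 2 iGv; have i3 := integrable_sub i2 iv.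
have E2 : \int[(P \x gauss)%E]_z (2 * (G z.1 * v z)) = 2 * explained pi a.
  exact: etrans (RintegralZl 2 measurableT iGv) (congr1 ( *%R 2) (congr1 fine EGv)).
have E3 : \int[(P \x gauss)%E]_z (2 * (G z.1 * v z) - v z ^+ 2) =
    2 * explained pi a - explained pi a.
  exact: etrans (RintegralB measurableT i2 iv)
    (congr2 (fun x y => x - y) E2 (congr1 fine Ev)).
have E4 : \int[(P \x gauss)%E]_z (G z.1 ^+ 2) = explained pi b := congr1 fine EG.
rewrite -E3 -E4; apply: (le_Rintegral measurableT i3 iG).
by move=> z _; exact: polarization_le.
Qed.

Lemma explained_nondecreasing a b : 0 <= a -> a <= b ->
  explained pi a <= explained pi b.
Proof.
by move=> a0; rewrite le_eqVlt => /predU1P[->//|]; exact: explained_lt.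
Qed.
End monotonicity.

(** * Continuity of the MMSE *)

Lemma dist_lt_of_bounds (R : realDomainType) (x y e : R) :
  x - e < y -> 1 - x - e < 1 - y -> `|x - y| < e.
Proof. by move=> h1 h2; rewrite ltr_distl; apply/andP; split; lra. Qed.

Section continuity.
Context {R : realType}.
Local Notation mu := (@lebesgue_measure R).
Local Notation RR := (measurableTypeR R * measurableTypeR R)%type.
Context (pi : probability (measurableTypeR R) R).
Local Notation P := (channel_prob pi).
Hypothesis mean0 : (\int[pi]_x x%:E = 0)%E.
Hypothesis sqr1 : (\int[pi]_x (x ^+ 2)%:E = 1)%E.

(** [W] and [V] split the second unnormalized posterior moment into the square
    of the posterior mean and the posterior variance, both weighted by the output
    density. *)
Let W (t y : R) := postmean pi t y ^+ 2 * outpdf pi t y.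
Let V (t y : R) := lik_moment pi (fun x => x ^+ 2) t y - W t y.

Let W0 t y : 0 <= W t y.
Proof. by rewrite mulr_ge0 ?sqr_ge0// ltW// outpdf_gt0. Qed.

Let V0 t y : 0 <= V t y.
Proof. by rewrite subr_ge0 sqr_postmean_le. Qed.

Let mW t : measurable_fun [set: R] (W t).
Proof.
apply: measurable_funM; last exact: measurable_outpdf.
by apply: measurable_funX; exact: measurable_postmean.
Qed.

Let mX2 t : measurable_fun [set: R] (lik_moment pi (fun x => x ^+ 2) t).
Proof. by apply: measurable_lik_moment; exact: integrable_sqr_pi. Qed.

Let mV t : measurable_fun [set: R] (V t).
Proof. exact: measurable_funB (mX2 t) (mW t). Qed.

Let integralW t : (\int[mu]_y (W t y)%:E = (explained pi t)%:E)%E.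
Proof.
rewrite (explainedE mean0 sqr1).
rewrite (@ge0_integral_output _ _ (fun y => postmean pi t y ^+ 2)).
- by [].
- by apply: measurable_funX; exact: measurable_postmean.
- by move=> y; exact: sqr_ge0.
Qed.

Let integralX2 t : (\int[mu]_y (lik_moment pi (fun x => (x ^+ 2)%R) t y)%:E = 1)%E.
Proof.
transitivity (\int[P]_w (w.1 ^+ 2 * cst 1 (t * w.1 + w.2))%:E)%E.
  rewrite (@ge0_integral_input_output _ _ (fun x => x ^+ 2) (cst 1)).
  - by apply: eq_integral => y _; rewrite mul1r.
  - exact: integrable_sqr_pi.
  - by move=> x; exact: sqr_ge0.
  - exact: measurable_cst.
  - by move=> y; exact: ler01.
by rewrite -(integral_input_sqr sqr1); apply: eq_integral => w _; rewrite mulr1.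
Qed.

Let integralV t : (\int[mu]_y (V t y)%:E = (1 - explained pi t)%:E)%E.
Proof.
have : (\int[mu]_y (V t y)%:E + \int[mu]_y (W t y)%:E = 1)%E.
  rewrite -ge0_integralD; last 5 first.
  - exact: measurableT.
  - by move=> y _; rewrite lee_fin V0.
  - by apply/measurable_EFinP; exact: mV.
  - by move=> y _; rewrite lee_fin W0.
  - by apply/measurable_EFinP; exact: mW.
  rewrite -(integralX2 t); apply: eq_integral => y _.
  by rewrite -EFinD /V subrK.
by rewrite integralW EFinB => <-; rewrite addeK.
Qed.

Let cW y : continuous (W ^~ y).
Proof.
have cf : continuous (fun t => outpdf pi t y).
  by apply: continuous_lik_momentl; exact: integrable_cst_pi.
have cm : continuous (fun t => postmean pi t y).
  move=> t; apply: cvgM.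
    by apply: continuous_lik_momentl; exact: integrable_id_pi.
  by apply: cvgV; [rewrite gt_eqF// outpdf_gt0|exact: cf].
move=> t; apply: cvgM; last exact: cf.
rewrite (_ : (fun x => postmean pi x y ^+ 2) =
    (fun x => postmean pi x y * postmean pi x y)).
  by apply: cvgM; exact: cm.
by apply/funext => x; rewrite expr2.
Qed.

Let cV y : continuous (V ^~ y).
Proof.
move=> t; apply: cvgB; last exact: cW.
by apply: continuous_lik_momentl; exact: integrable_sqr_pi.
Qed.

(** The natural dominating function would require a third moment of the input,
    because the output of an input [x] sweeps an interval of length proportional to
    [x] when [t] varies. Lower semicontinuity of the integrals of both [W] and [V],
    whose sum is constant, is used instead. *)
Lemma continuous_explained : continuous (explained pi).
Proof.
move=> t; apply/(@cvg_nbhsP _ R^o) => u ut.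
have conv (f : R -> R) : continuous f -> f (u n) @[n --> \oo] --> f t.
  by move=> cf; apply: continuous_cvg => //; exact: cf.
apply/cvgrPdist_lt => eps eps0.
have lo : \forall n \near \oo, explained pi t - eps < explained pi (u n).
  apply: (@fatou_near _ _ _ mu (fun n => W (u n)) (W t)).
  - by move=> n; exact: mW.
  - by move=> n x; exact: W0.
  - by move=> y; apply: (conv (W ^~ y)); exact: cW.
  - by move=> n; exact: integralW.
  - exact: integralW.
  - by rewrite ltrBlDr ltrDl.
have hi : \forall n \near \oo, 1 - explained pi t - eps < 1 - explained pi (u n).
  apply: (@fatou_near _ _ _ mu (fun n => V (u n)) (V t)).
  - by move=> n; exact: mV.
  - by move=> n x; exact: V0.
  - by move=> y; apply: (conv (V ^~ y)); exact: cV.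
  - by move=> n; exact: integralV.
  - exact: integralV.
  - by rewrite ltrBlDr ltrDl.
near=> n; apply: dist_lt_of_bounds; near: n; [exact: lo|exact: hi].
Unshelve. all: by end_near. Qed.
End continuity.

(** * The derivative of the mutual information *)

Lemma sqr_subr_sqrt_le (R : realType) (s s' : R) : 0 < s -> 0 <= s' ->
  (Num.sqrt s' - Num.sqrt s) ^+ 2 <= (s' - s) ^+ 2 / s.
Proof.
move=> s0 s'0; rewrite ler_pdivlMr//.
have -> : (s' - s) ^+ 2 =
    (Num.sqrt s' - Num.sqrt s) ^+ 2 * (Num.sqrt s' + Num.sqrt s) ^+ 2.
  by rewrite -exprMn -subr_sqr !sqr_sqrtr// ltW.
apply: ler_wpM2l; first exact: sqr_ge0.
rewrite -[leLHS](sqr_sqrtr (ltW s0)) lerXn2r ?nnegrE ?addr_ge0 ?sqrtr_ge0//.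
by rewrite lerDr sqrtr_ge0.
Qed.

(** The hypothesis makes [M s / 2] a supergradient of [I] up to a second-order
    error. Used in both directions, it yields the derivative wherever [M] is
    continuous. *)
Section supergradient.
Context {R : realType} (I M : R -> R).
Hypothesis incr : forall s s', 0 <= s -> 0 <= s' ->
  I s' - I s <= (s' - s) / 2 * M s + (Num.sqrt s' - Num.sqrt s) ^+ 2 / 2.

Lemma increment_error s s' : 0 < s -> 0 <= s' ->
  `|I s' - I s - (s' - s) * (M s / 2)| <=
  `|s' - s| * (`|M s' - M s| + `|s' - s| / s).
Proof.
move=> s0 s'0.
have h1 := incr (ltW s0) s'0.
have h2 := incr s'0 (ltW s0).
have h3 := sqr_subr_sqrt_le s0 s'0.
have h5 : 0 <= `|s' - s| * `|M s' - M s| by rewrite mulr_ge0.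
have h4 : - (`|s' - s| * `|M s' - M s|) <= (s' - s) * (M s' - M s).
  by rewrite -normrM lerNnormlW.
have q0 : 0 <= (Num.sqrt s' - Num.sqrt s) ^+ 2 by exact: sqr_ge0.
have -> : `|s' - s| * (`|M s' - M s| + `|s' - s| / s) =
    `|s' - s| * `|M s' - M s| + (s' - s) ^+ 2 / s.
  by rewrite mulrDr mulrA -expr2 real_normK// num_real.
rewrite -(opprB (Num.sqrt s)) sqrrN in h3 q0 h1.
by rewrite ler_norml; apply/andP; split; lra.
Qed.

Lemma is_derive_supergradient (s : R) : 0 < s -> {for s, continuous M} ->
  is_derive s (1 : R) I (M s / 2).
Proof.
move=> s0 cM.
suff h : (h^-1 *: ((I \o shift s) (h *: (1 : R)) - I s) @[h --> 0^'] --> M s / 2).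
  by split; [apply/cvg_ex; exists (M s / 2)|exact: cvg_lim h].
apply/cvgrPdist_le => eps eps0.
have e2 : 0 < eps / 2 by rewrite divr_gt0.
have cMs : \forall h \near 0^', `|M s - M (h + s)| <= eps / 2.
  have c0 : M (h + s) @[h --> (0 : R)] --> M s.
    have -> : M s = M (0 + s) by rewrite add0r.
    apply: (@continuous_comp _ _ _ (fun h : R => h + s) M).
      by apply: cvgD; [exact: cvg_id|exact: cvg_cst].
    by rewrite add0r.
  have /cvgrPdist_le/(_ _ e2) := c0.
  exact: nbhs_dnbhs.
near=> h.
have h0 : h != 0 by near: h; exact: nbhs_dnbhs_neq.
have hs : `|h| < s.
  by near: h; apply: dnbhs0_lt.
have he : `|h| < eps / 2 * s.
  by near: h; apply: dnbhs0_lt; rewrite mulr_gt0.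
have hM : `|M s - M (h + s)| <= eps / 2 by near: h.
rewrite /= /shift/= scaler1.
have sh0 : 0 <= h + s.
  by rewrite -lerBlDr sub0r; apply: ltW; move: hs; rewrite ltr_norml => /andP[].
have := increment_error s0 sh0; rewrite addrK => err.
have -> : M s / 2 - h^-1 *: (I (h + s) - I s) =
    - h^-1 * (I (h + s) - I s - h * (M s / 2)).
  by rewrite /GRing.scale/=; field.
rewrite normrM normrN normfV ler_pdivrMl ?normr_gt0//.
apply: (le_trans err); rewrite ler_wpM2l//.
have : `|h| / s <= eps / 2 by rewrite ler_pdivrMr// ltW.
rewrite distrC in hM; move: hM; lra.
Unshelve. all: by end_near. Qed.
End supergradient.

Section i_mmse.
Context {R : realType}.
Context (pi : probability (measurableTypeR R) R).
Hypothesis mean0 : (\int[pi]_x x%:E = 0)%E.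
Hypothesis sqr1 : (\int[pi]_x (x ^+ 2)%:E = 1)%E.

Lemma M_fun_ge0 s : 0 <= M_fun pi s.
Proof. by rewrite (M_funE mean0 sqr1) subr_ge0 explained_le1. Qed.

Lemma M_fun_le1 s : M_fun pi s <= 1.
Proof. by rewrite (M_funE mean0 sqr1) gerBl explained_ge0. Qed.

Lemma M_fun_nonincreasing s s' : s <= s' -> M_fun pi s' <= M_fun pi s.
Proof.
move=> ss'; rewrite !(M_funE mean0 sqr1) lerD2l lerN2.
by apply: explained_nondecreasing; rewrite ?sqrtr_ge0 ?ler_wsqrtr.
Qed.

Lemma continuous_M_fun : continuous (M_fun pi).
Proof.
rewrite (_ : M_fun pi = fun s => 1 - explained pi (Num.sqrt s)); last first.
  by apply/funext => s; rewrite (M_funE mean0 sqr1).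
move=> s; apply: cvgB; first exact: cvg_cst.
apply: (continuous_comp (@sqrt_continuous R s)).
exact: continuous_explained.
Qed.

Lemma I_fun_increment s s' : 0 <= s -> 0 <= s' ->
  I_fun pi s' - I_fun pi s <=
  (s' - s) / 2 * M_fun pi s + (Num.sqrt s' - Num.sqrt s) ^+ 2 / 2.
Proof.
move=> s0 s'0; rewrite !(I_funE mean0 sqr1) (M_funE mean0 sqr1).
have := info_mmse_upper mean0 sqr1 (Num.sqrt s) (Num.sqrt s').
by rewrite !sqr_sqrtr.
Qed.

Lemma is_derive_I_fun (s : R) : 0 < s ->
  is_derive s (1 : R) (I_fun pi) (M_fun pi s / 2).
Proof.
move=> s0; apply: is_derive_supergradient => //; first exact: I_fun_increment.
exact: continuous_M_fun.
Qed.
End i_mmse.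

(** * Stationary points and the AMP threshold *)

Section stationary.
Context {R : realType}.
Context (pi : probability (measurableTypeR R) R).
Hypothesis mean0 : (\int[pi]_x x%:E = 0)%E.
Hypothesis sqr1 : (\int[pi]_x (x ^+ 2)%:E = 1)%E.
Context (delta snr : R).
Hypothesis delta0 : 0 < delta.
Hypothesis snr0 : 0 < snr.

Lemma is_derive_phi_scale (c s : R) : 0 < c -> 0 < s ->
  is_derive s (1 : R) (fun s => phi (s / c)) (c^-1 - s^-1).
Proof.
move=> c0 s0.
have dg : is_derive s (1 : R) (fun s => s / c) c^-1.
  have := @is_deriveZ R R R id c^-1 s 1 1 (is_derive_id _ _).
  rewrite (_ : c^-1 \*: id = fun s => s / c); last first.
    by apply/funext => x; rewrite /= mulrC.
  by rewrite /GRing.scale/= mulr1.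
have sc0 : 0 < s / c by rewrite divr_gt0.
have dl := @is_derive1_comp R (@ln R) (fun s => s / c) s _ _ (is_derive1_ln sc0) dg.
have := is_deriveB (is_deriveB dg dl) (is_derive_cst (1 : R) s (1:R)).
have -> : c^-1 - (s / c)^-1 * c^-1 - 0 = c^-1 - s^-1.
  by field; rewrite !gt_eqF.
by [].
Qed.

Lemma is_derive_potential (s : R) : 0 < s ->
  is_derive s (1 : R) (potential delta snr pi)
    (M_fun pi s / 2 + delta / 2 * ((delta * snr)^-1 - s^-1)).
Proof.
move=> s0; have dsnr : 0 < delta * snr by rewrite mulr_gt0.
have := is_deriveD (is_derive_I_fun mean0 sqr1 s0)
  (is_deriveZ (delta / 2) (is_derive_phi_scale dsnr s0)).
exact.
Qed.

Lemma stationaryP (s : R) : stationary_points (potential delta snr pi) s <->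
  0 < s /\ s * (M_fun pi s * snr + 1) = delta * snr.
Proof.
have E (t : R) : 0 < t -> M_fun pi t / 2 + delta / 2 * ((delta * snr)^-1 - t^-1) =
    (t * (M_fun pi t * snr + 1) - delta * snr) / (2 * t * snr).
  by move=> t0; field; rewrite !gt_eqF.
split=> [[s0 ds]|[s0 eqs]].
  rewrite derive1E (@derive_val _ _ _ _ _ _ _ (is_derive_potential s0)) E// => /eqP.
  rewrite mulf_eq0 invr_eq0 !mulf_eq0 pnatr_eq0 (gt_eqF s0) (gt_eqF snr0).
  rewrite !orbF subr_eq0.
  by move=> /eqP.
split => //; first exact: (@ex_derive _ _ _ _ _ _ _ (is_derive_potential s0)).
rewrite derive1E (@derive_val _ _ _ _ _ _ _ (is_derive_potential s0)) E//.
by rewrite eqs subrr mul0r.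
Qed.

(** The left-hand side of the equation in [stationaryP] is continuous. It is
    at most [s * (snr + 1)], hence at most [delta * snr] at [a], and the hypothesis
    says that it is large enough at [x]. *)
Lemma exists_stationary (x : R) : 0 < x ->
  delta * snr <= x * (M_fun pi x * snr + 1) ->
  exists2 s, stationary_points (potential delta snr pi) s & s <= x.
Proof.
move=> x0 hx.
pose h s := s * (M_fun pi s * snr + 1).
have snr1 : 0 < snr + 1 by rewrite addr_gt0.
have hle s : 0 <= s -> h s <= s * (snr + 1).
  move=> s0; apply: ler_wpM2l => //; rewrite lerD2r.
  by rewrite ler_piMl ?M_fun_le1// ltW.
pose a := delta * snr / (snr + 1).
have a0 : 0 < a by rewrite divr_gt0// mulr_gt0.
have ax : a <= x.
  by rewrite ler_pdivrMr//; apply: (le_trans hx); exact: hle (ltW x0).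
have ha : h a <= delta * snr.
  by apply: (le_trans (hle _ (ltW a0))); rewrite /a divfK// gt_eqF.
have ch : continuous h.
  move=> s; apply: cvgM; first exact: cvg_id.
  apply: cvgD; last exact: cvg_cst.
  apply: cvgM; last exact: cvg_cst.
  exact: continuous_M_fun.
have [||s] := @IVT R h a x (delta * snr) ax.
- exact: continuous_subspaceT.
- apply/andP; split; first by rewrite ge_min; apply/orP; left; exact: ha.
  by rewrite le_max; apply/orP; right; exact: hx.
rewrite in_itv/= => /andP[as_ sx] hs; exists s => //.
by apply/stationaryP; split => //; exact: lt_le_trans as_.
Qed.

Lemma stationary_nonempty : stationary_points (potential delta snr pi) !=set0.
Proof.
have dsnr : 0 < delta * snr by rewrite mulr_gt0.
have [||s ss _] := @exists_stationary (delta * snr); [exact: dsnr| |by exists s].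
have M0 := M_fun_ge0 mean0 sqr1 (delta * snr).
by rewrite ler_peMr ?(ltW dsnr)// lerDr mulr_ge0// ltW.
Qed.

Lemma s_AMP_le (x : R) : 0 < x ->
  delta * snr <= x * (M_fun pi x * snr + 1) -> s_AMP delta snr pi <= x.
Proof.
move=> x0 /(exists_stationary x0)[s ss sx]; apply: le_trans sx.
by apply: ge_inf => //; exists 0 => y [/ltW].
Qed.

(** Every stationary point solves the equation of [stationaryP] with an MMSE at
    most 1. Existence of one matters, since the infimum of the empty set is 0. *)
Lemma s_AMP_ge (x : R) : x * (snr + 1) <= delta * snr -> x <= s_AMP delta snr pi.
Proof.
move=> hx; apply: lb_le_inf.
  exact: stationary_nonempty.
move=> s /stationaryP[s0 hs].
have snr1 : 0 < snr + 1 by rewrite addr_gt0.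
rewrite -(ler_pM2r snr1) (le_trans hx)// -hs; apply: ler_wpM2l; first exact: ltW.
by rewrite lerD2r ler_piMl ?M_fun_le1// ltW.
Qed.
End stationary.

Lemma standardized_moments (R : realType) (pi : probability (measurableTypeR R) R) :
  ('E_pi[(fun x : R => x)] = 0)%E -> ('V_pi[(fun x : R => x)] = 1)%E ->
  (\int[pi]_x x%:E = 0)%E /\ (\int[pi]_x (x ^+ 2)%:E = 1)%E.
Proof.
move=> E0 V1; split; first by rewrite -E0 unlock.
rewrite -V1 /variance unlock E0 unlock; apply: eq_integral => x _.
by rewrite /= !fctE /cst/= subr0 expr2.
Qed.

Lemma below_threshold_le (R : realDomainType) (h snr t m rho : R) :
  0 <= h -> 0 <= snr -> 0 <= t -> m <= 1 -> rho <= t * m ->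
  rho * (2 * h) * (snr + 1) <= 2 * h * t * (m * snr + 1).
Proof.
move=> h0 snr0 t0 m1 rm; rewrite [rho * _]mulrC -!mulrA.
apply: ler_wpM2l => //; apply: ler_wpM2l => //.
apply: (@le_trans _ _ (t * m * (snr + 1))).
  by apply: ler_wpM2r => //; rewrite addr_ge0.
by rewrite -mulrA; apply: ler_wpM2l => //; rewrite mulrDr mulr1 lerD2l.
Qed.

Theorem theorem6 (R : realType)
    (pi : R -> probability (measurableTypeR R) R)
    (pi_discrete : forall e, 0 < e -> discrete_distribution (pi e))
    (pi_mean : forall e, 0 < e -> ('E_(pi e)[(fun x : R => x)] = 0)%E)
    (pi_variance : forall e, 0 < e -> ('V_(pi e)[(fun x : R => x)] = 1)%E)
    (pi_entropy : forall e, 0 < e -> (entropy (pi e) < +oo)%E)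
    (mmse_lt1 : forall t : R, 0 <= t < 1 ->
      M_fun (pi e) (2 * fine (entropy (pi e)) * t) @[e --> 0^'+] --> (1 : R))
    (mmse_gt1 : forall t : R, 1 < t ->
      M_fun (pi e) (2 * fine (entropy (pi e)) * t) @[e --> 0^'+] --> (0 : R))
    (r : R) (r_range : 0 < r < 1 \/ 1 < r)
    (delta snr : R -> R)
    (delta_gt0 : forall e, 0 < e -> 0 < delta e)
    (snr_gt0 : forall e, 0 < e -> 0 < snr e)
    (delta_ratio : delta e / delta_AMP (snr e) (pi e) @[e --> 0^'+] --> r) :
  (0 < r < 1 ->
    M_fun (pi e) (s_AMP (delta e) (snr e) (pi e)) @[e --> 0^'+] --> (1 : R)) /\
  (1 < r ->
    M_fun (pi e) (s_AMP (delta e) (snr e) (pi e)) @[e --> 0^'+] --> (0 : R)).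
Proof.
have moments e (e0 : 0 < e) := standardized_moments (pi_mean e e0) (pi_variance e e0).
pose H e := fine (entropy (pi e)).
pose rho e := delta e / delta_AMP (snr e) (pi e).
(* a quotient by zero is zero, so a positive ratio already forces positive entropy *)
have H_gt0 e : 0 < e -> 0 < rho e -> 0 < H e.
  move=> e0; rewrite /rho pmulr_rgt0 ?delta_gt0// invr_gt0 /delta_AMP -/(H e).
  have s0 := snr_gt0 e e0.
  by rewrite pmulr_lgt0 ?invr_gt0// pmulr_lgt0 ?addr_gt0// pmulr_rgt0.
have deltaE e : 0 < e -> 0 < rho e ->
    delta e * snr e = rho e * (2 * H e) * (snr e + 1).
  move=> e0 r0; have h0 := H_gt0 e e0 r0; have s0 := snr_gt0 e e0.
  rewrite /rho /delta_AMP -/(H e); field.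
  by rewrite !gt_eqF// addr_gt0.
have pos : \forall e \near 0^'+, 0 < (e : R) by exact: nbhs_right_gt.
split=> [/andP[r0 r1]|r1].
- pose t := (r + 1) / 2.
  have rt : r < t by rewrite /t; lra.
  have t1 : t < 1 by rewrite /t; lra.
  have t0 : 0 < t by exact: lt_trans rt.
  have Mt : M_fun (pi e) (2 * H e * t) @[e --> 0^'+] --> (1 : R).
    by apply: mmse_lt1; rewrite t1 ltW.
  have rho0 : \forall e \near 0^'+, 0 < rho e by exact: cvgr_gt delta_ratio _ r0.
  have tM : \forall e \near 0^'+, 0 < t * M_fun (pi e) (2 * H e * t) - rho e.
    have c : t * M_fun (pi e) (2 * H e * t) - rho e @[e --> 0^'+] --> t * 1 - r.
      by apply: cvgB => //; apply: cvgM => //; exact: cvg_cst.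
    by apply: cvgr_gt c _ _; rewrite mulr1 subr_gt0.
  apply: (@squeeze_cvgr _ _ _ _ (fun e => M_fun (pi e) (2 * H e * t))
    (fun=> 1)) => //; last exact: cvg_cst.
  near=> e.
  have e0 : 0 < e by near: e.
  have re : 0 < rho e by near: e.
  have te : 0 < t * M_fun (pi e) (2 * H e * t) - rho e by near: e.
  have [m1 m2] := moments e e0.
  have h0 := H_gt0 e e0 re; have s0 := snr_gt0 e e0.
  apply/andP; split; last exact: (M_fun_le1 m1 m2).
  apply: (M_fun_nonincreasing m1 m2).
  apply: (s_AMP_le m1 m2 (delta_gt0 e e0) s0).
    exact: mulr_gt0 (mulr_gt0 (ltr0Sn _ 1) h0) t0.
  rewrite (deltaE e e0 re); rewrite subr_gt0 in te.
  exact: below_threshold_le (ltW h0) (ltW s0) (ltW t0) (M_fun_le1 m1 m2 _) (ltW te).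
- pose t := (r + 1) / 2.
  have tr : t < r by rewrite /t; lra.
  have t1 : 1 < t by rewrite /t; lra.
  have Mt := mmse_gt1 t t1.
  have rhot : \forall e \near 0^'+, t < rho e by exact: cvgr_gt delta_ratio _ tr.
  apply: (@squeeze_cvgr _ _ _ _ (fun=> 0)
    (fun e => M_fun (pi e) (2 * H e * t))) => //; last exact: cvg_cst.
  near=> e.
  have e0 : 0 < e by near: e.
  have te : t < rho e by near: e.
  have re : 0 < rho e by apply: lt_trans te; apply: lt_trans t1.
  have [m1 m2] := moments e e0.
  have h0 := H_gt0 e e0 re; have s0 := snr_gt0 e e0.
  apply/andP; split; first exact: (M_fun_ge0 m1 m2).
  apply: (M_fun_nonincreasing m1 m2).
  apply: (s_AMP_ge m1 m2 (delta_gt0 e e0) s0).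
  rewrite (deltaE e e0 re) [rho e * _]mulrC; apply: ler_wpM2r.
    by rewrite addr_ge0// ltW.
  by apply: ler_wpM2l; [rewrite mulr_ge0// ltW|exact: ltW].
Unshelve. all: by end_near. Qed.
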